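(* Let $s,q,a,b$ be integers satisfying $s\ge 2$, $a\ge 0$, and $q=a\binom{s}{2}+b$. As $n\to\infty$ (with $s,q,a,b$ fixed): (i) If $0\le b\le s-2$, then $|F(n,s,q)|=(a+1)^{\binom{n}{2}}2^{o(n^2)}$. (ii) If $b=\binom{s}{2}-t$ where $2\le t\le\frac{s}{2}$, then $|F(n,s,q)|=(a+1)^{\binom{n}{2}}\big(\frac{a+2}{a+1}\big)^{t_{s-t}(n)+o(n^2)}$. (iii) $|F(n,4,3)|=2^{\Theta(n^{3/2})}$.
   Context: For a set $X$, $\binom{X}{t}$ is the set of $t$-element subsets of $X$; $[n]=\{1,\dots,n\}$; $\mathbb{N}=\{0,1,2,\dots\}$. A multigraph is a pair $(V,w)$ where $V$ is a finite vertex set and $w:\binom{V}{2}\to\mathbb{N}$. $F(n,s,q)$ is the set of multigraphs $([n],w)$ such that $\sum_{xy\in\binom{X}{2}}w(xy)\le q$ for every $X\in\binom{[n]}{s}$. $t_r(n)$ is the number of edges of the Turán graph $T_r(n)$, the complete $r$-partite graph on $n$ vertices whose part sizes pairwise differ by at most $1$. *)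

(* Defs.v *)
From HB Require Import structures.
From mathcomp Require Import all_boot all_order all_algebra finmap.
From mathcomp Require Import all_classical all_reals all_analysis.

Set Implicit Arguments.
Unset Strict Implicit.
Unset Printing Implicit Defensive.

Import Order.TTheory GRing.Theory Num.Theory.
Import numFieldNormedType.Exports.

Local Open Scope classical_set_scope.
Local Open Scope nat_scope.

Definition pairs (V : finType) := {e : {set V} | #|e| == 2}.

(* The multigraphs with vertex set V, identified with their weight functions. *)
Definition multigraph (V : finType) := {ffun pairs V -> nat}.

Definition weight (V : finType) (w : multigraph V) (X : {set V}) : nat :=
  \sum_(e : pairs V | val e \subset X) w e.

(* The vertex set [n] is rendered as 'I_n = {0, ..., n - 1}. *)
Definition F (n s q : nat) : set (multigraph 'I_n) :=
  [set w | forall X : {set 'I_n}, #|X| = s -> weight w X <= q].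

(* For 2 <= s <= n the set F n s q is finite.  For n < s it is the set of all
   multigraphs; if this is infinite then fset_set, hence cardF, takes the default
   value fset0, resp. 0. *)
Definition cardF (n s q : nat) : nat := #|` fset_set (@F n s q)|.

Definition multipartite_edges (V : finType) (r : nat) (part : V -> 'I_r) :
    {set pairs V} :=
  [set e : pairs V | [exists x in val e, exists y in val e, part x != part y]].

Definition balanced (V : finType) (r : nat) (part : V -> 'I_r) : Prop :=
  forall i j : 'I_r,
    #|[set x | part x == i]%SET| <= #|[set x | part x == j]%SET|.+1.

(* Parts are the residue classes modulo r; the number of parts is r.+1 so that
   the type of parts is inhabited. *)
Definition turan_part (r n : nat) (x : 'I_n) : 'I_r.+1 := inord (x %% r.+1).

Definition turan_graph (r n : nat) : {set pairs 'I_n} :=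
  multipartite_edges (@turan_part r.-1 n).

(* Meaningful for 0 < r. *)
Definition turan_number (r n : nat) : nat := #|turan_graph r n|.

Lemma turan_part_balanced (r n : nat) : balanced (@turan_part r n).
Proof.
move=> i j.
have pE (x : 'I_n) (k : 'I_r.+1) : (turan_part r x == k) = (x %% r.+1 == k).
  by rewrite -val_eqE /= inordK // ltn_mod.
have le_i : #|[set x : 'I_n | turan_part r x == i]%SET| <= (n %/ r.+1).+1.
  have hf (x : 'I_n) : x %/ r.+1 < (n %/ r.+1).+1.
    by rewrite ltnS leq_div2r // ltnW.
  rewrite -[leqRHS]card_ord.
  rewrite -(card_in_imset (f := fun x : 'I_n => Ordinal (hf x))) ?max_card //.
  move=> x y; rewrite !inE !pE => /eqP xi /eqP yi [xy]; apply: val_inj => /=.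
  by rewrite (divn_eq x r.+1) (divn_eq y r.+1) xi yi xy.
have ge_j : n %/ r.+1 <= #|[set x : 'I_n | turan_part r x == j]%SET|.
  have hg (k : 'I_(n %/ r.+1)) : k * r.+1 + j < n.
    apply: (@leq_trans (n %/ r.+1 * r.+1)); last exact: leq_divM.
    apply: (@leq_trans (k.+1 * r.+1)); last by rewrite leq_mul2r ltn_ord orbT.
    by rewrite mulSn [leqRHS]addnC ltn_add2l.
  rewrite -[leqLHS]card_ord -(card_imset (f := fun k => Ordinal (hg k))).
    apply: subset_leq_card; apply/fintype.subsetP => x /imsetP[k _ ->].
    by rewrite inE pE /= modnMDl modn_small.
  move=> k l [] /eqP; rewrite eqn_add2r eqn_mul2r /= => /eqP.
  exact: val_inj.
exact: leq_trans le_i _.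
Qed.

(* Main.v *)
Require Import Defs.
From HB Require Import structures.
From mathcomp Require Import all_boot all_order all_algebra finmap.
From mathcomp Require Import all_classical all_reals all_analysis.
From mathcomp Require Import finfield.
From mathcomp Require Import fintype finset fingroup perm zify ring lra.

(** The lower bounds come from constructions all of whose sub-multigraphs are sparse: all
    weights at most $a$ for (i); weights at most $a+1$ on the Turan graph $T_{s-t}(n)$ and at
    most $a$ elsewhere for (ii); the subgraphs of the point-line incidence graph of an affine
    plane for (iii).

    Upper bounds in (i) and (ii). First, a greedy argument ([sparse_weight_le]): in a sparse
    multigraph the average weight of the pairs is at most $c + o(1)$, with $c = a$ in (i) and
    $c = a + 1 - 1/(s-t)$ in (ii), since a multigraph of larger minimum degree contains $s$
    vertices of total weight more than $q$. To pass from this to counting, let $w$ be a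
    uniformly random element of $F(n,s,q)$ and reveal all pairs meeting a set $T$ of boundedly
    many vertices. The energy, that is the mean square of the conditional probabilities of the
    weight of a pair, increases with $T$ and by symmetry only depends on $|T|$; hence $T$ can be
    chosen so that revealing $n_0$ more vertices hardly changes it ([stable_segment]). By
    Pythagoras' theorem the weights on a set $S$ of $n_0$ new vertices are then nearly
    independent given the revealed pairs ([seq_decouple]), so the multigraph $m$ on $S$ formed
    by the largest weights that are not unlikely is itself sparse with high probability
    ([impossible_rare]). Encoding $w$ by the revealed pairs and, for each other pair, its weight
    among the $m(e) + 1$ likely values, Gibbs' inequality bounds $\ln |F(n,s,q)|$ by
    $o(n^2)$ plus the mean of the sum of the $\ln(m(e)+1)$ ([counting_bound]). Since $\ln$ is
    concave, $\ln(m+1)$ lies below its chord through $a$ and $a+1$, and the greedy bound for the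
    sum of the $m(e)$ over $S$ finishes the proof.

    Upper bound in (iii). A multigraph in $F(n,4,3)$ is determined by three level sets, which
    are graphs with at most three edges on any four vertices, in particular without 4-cycles.
    These are counted following Kleitman and Winston: remove a vertex of minimum degree
    ([card_family_rec]); its neighbourhood is a set of vertices without two that have a common
    neighbour in the remaining graph $H$. In any large set of vertices some vertex shares a
    neighbour with many others ([second_nbhd_large]), so there are only
    $2^{O(\sqrt n)}$ such sets ([indep_subsets_le], [card_extensions]). *)

Set Implicit Arguments.
Unset Strict Implicit.
Unset Printing Implicit Defensive.

Import Order.TTheory GRing.Theory Num.Theory.
Import numFieldNormedType.Exports.

Local Open Scope ring_scope.

(** * Weights of vertex sets and the greedy extremal bound *)

Section Weights.
Local Open Scope nat_scope.
Variables (V : finType) (w : multigraph V).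
Implicit Types (x y : V) (X Y : {set V}).

(** The weight of the pair $xy$, equal to $0$ when $x = y$. *)
Definition pair_weight x y : nat := \sum_(e : pairs V | val e == [set x; y]%SET) w e.

Lemma pair_weightC x y : pair_weight x y = pair_weight y x.
Proof. by rewrite /pair_weight setUC. Qed.

(** A pair containing $x$ is $xy$ for some other vertex $y$. *)
Lemma pair_other x (e : pairs V) : x \in val e ->
  exists2 y, y != x & val e = [set x; y]%SET.
Proof.
move=> xe; have /cards1P[y ye] : #|val e :\ x| == 1%N.
  by have := cardsD1 x (val e); have /eqP-> := valP e; rewrite xe add1n => -[<-].
have /setD1P[yx _] : y \in val e :\ x by rewrite ye set11.
by exists y => //; rewrite -ye (setD1K xe).
Qed.

Lemma set2_inj x y y' : y != x -> y' != x ->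
  [set x; y]%SET = [set x; y']%SET -> y = y'.
Proof.
move=> yx y'x E; have : y \in [set x; y']%SET by rewrite -E set22.
by rewrite !inE (negPf yx) => /eqP.
Qed.

Lemma weightU1 x Y : x \notin Y ->
  weight w (x |: Y)%SET = weight w Y + \sum_(y in Y) pair_weight x y.
Proof.
move=> xY; rewrite /weight (bigID (fun e : pairs V => x \in val e)) [LHS]addnC /=.
congr (_ + _).
  apply: eq_bigl => e; apply/andP/idP => [[/subsetP sub xe]|/subsetP sub].
    apply/subsetP => z ze; have := sub z ze; rewrite !inE.
    by case/orP => // /eqP zx; rewrite -zx ze in xe.
  split; first by apply/subsetP => z /sub; rewrite !inE orbC => ->.
  by apply: contra xY => /sub.
rewrite /pair_weight (exchange_big_dep
  (fun e : pairs V => (val e \subset (x |: Y)%SET) && (x \in val e))) /=; last first.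
  move=> y e yY /eqP ->; rewrite set21 andbT.
  by apply/subsetP => z; rewrite !inE => /orP[|] /eqP->; rewrite ?eqxx ?yY ?orbT.
apply: eq_bigr => e /andP[/subsetP sub xe].
have [y yx ee] := pair_other xe.
rewrite (big_pred1 y) // => z /=; apply/andP/eqP => [[zY /eqP]|->].
  rewrite ee => /set2_inj-> //.
  by apply: contraNneq xY => <-.
split; last by rewrite ee.
by have := sub y; rewrite ee set22 !inE (negPf yx) => /(_ isT).
Qed.

Lemma weight_subset X Y : X \subset Y -> weight w X <= weight w Y.
Proof.
move=> sub; rewrite /weight [leqRHS](bigID (fun e : pairs V => val e \subset X)) /=.
apply: leq_trans (leq_addr _ _); apply: eq_leq; apply: eq_bigl => e.
by apply/idP/andP => [eX|[]//]; split=> //; apply: subset_trans sub.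
Qed.

Lemma pair_weightxx x : pair_weight x x = 0.
Proof.
rewrite /pair_weight big1 // => e /eqP ee; have := valP e.
by rewrite /= ee setUid cards1.
Qed.

Lemma pair_weight_star X x : x \in X ->
  \sum_(y in X) pair_weight x y <= weight w X.
Proof.
move=> xX; rewrite -{2}(setD1K xX) weightU1 ?setD11 //.
rewrite (big_setD1 x) //= pair_weightxx add0n; exact: leq_addl.
Qed.

(** A set can be enlarged inside $Y$ to any prescribed intermediate size. *)
Lemma superset_card X Y k : X \subset Y -> #|X| <= k <= #|Y| ->
  exists Z : {set V}, [/\ X \subset Z, Z \subset Y & #|Z| = k].
Proof.
move=> XY; elim: k => [|k IH] /andP[].
  by move=> X0 _; exists X; split=> //; apply/eqP; rewrite -leqn0.
rewrite leq_eqVlt => /orP[/eqP Xk _|Xk kY]; first by exists X; split.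
have [|Z [XZ ZY Zk]] := IH; first by rewrite -ltnS Xk ltnW.
have /subsetPn[y yY yZ] : ~~ (Y \subset Z).
  by apply: contraL kY => /subset_leq_card; rewrite Zk -leqNgt.
exists (y |: Z)%SET; split; last by rewrite cardsU1 yZ Zk.
- by apply: subset_trans XZ _; rewrite subsetU1.
- by rewrite subUset sub1set yY.
Qed.

End Weights.

(** The extremal problem for multigraphs that are sparse on the subsets of $S$. Every integer
    larger than $ck$ is at least $g(k)$, and $q$ is smaller than the weight
    $\sum_k g(k)$ that a greedy choice of $s$ vertices gathers if all degrees are too large. *)
Section Extremal.
Variables (R : realType) (V : finType) (w : multigraph V) (S : {set V}) (s q : nat).
Variables (c : R) (g : nat -> nat).
Hypothesis s_gt0 : (0 < s)%N.
Hypothesis s_leS : (s <= #|S|)%N.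
Hypothesis w_sparse : forall X : {set V}, X \subset S -> #|X| = s -> (weight w X <= q)%N.
Hypothesis c_ge0 : 0 <= c.
Hypothesis g_le : forall k, (0 < k < s)%N -> (g k)%:R <= c * k%:R + 1.
Hypothesis g_sum : (q < \sum_(1 <= k < s) g k)%N.
Implicit Types X Y : {set V}.

Lemma weight_small X : X \subset S -> (#|X| <= s)%N -> (weight w X <= q)%N.
Proof.
move=> XS Xs; have [|Z [XZ ZS /(w_sparse ZS) Zq]] := superset_card (k := s) XS.
  by rewrite Xs.
exact: leq_trans (weight_subset _ XZ) Zq.
Qed.

(** If every vertex of $Y$ had degree larger than $c|Y| + q$ inside $Y$, then a set of $k$
    vertices could always be extended by a vertex sending it weight more than $ck$, hence at
    least $g(k)$; after $s - 1$ steps the weight would exceed $q$. *)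
Lemma low_degree_vertex Y : Y \subset S -> (s < #|Y|)%N ->
  exists2 v, v \in Y & (\sum_(y in Y) pair_weight w v y)%:R <= c * #|Y|%:R + q%:R.
Proof.
move=> YS sY; apply: contrapT => noV.
have high v : v \in Y ->
    c * #|Y|%:R + q%:R < (\sum_(y in Y) pair_weight w v y)%:R.
  by move=> vY; rewrite ltNge; apply/negP => vlow; apply: noV; exists v.
suff [X [XY Xs Xg]] : exists X : {set V},
    [/\ X \subset Y, #|X| = s & (\sum_(1 <= k < s) g k <= weight w X)%N].
  by have := leq_trans g_sum Xg; rewrite ltnNge weight_small ?Xs // (subset_trans XY).
have build k : (0 < k <= s)%N -> exists X : {set V},
    [/\ X \subset Y, #|X| = k & (\sum_(1 <= i < k) g i <= weight w X)%N].
  elim: k => [//|k IH] /andP[_ ks]; have [->|k_gt0] := posnP k.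
    have /card_gt0P[y yY] : (0 < #|Y|)%N by apply: leq_trans sY.
    by exists [set y]%SET; rewrite sub1set cards1 big_geq.
  have [|X [XY Xk Xg]] := IH; first by rewrite k_gt0 ltnW.
  have [v /setDP[vY vX] vg] : exists2 v, v \in Y :\: X &
      c * k%:R < (\sum_(x in X) pair_weight w v x)%:R.
    apply: contrapT => noE.
    have : (\sum_(v in Y :\: X) \sum_(x in X) pair_weight w v x)%:R <=
           c * k%:R * #|Y|%:R.
      rewrite natr_sum; apply: (@le_trans _ _ (\sum_(v in Y :\: X) (c * k%:R))).
        apply: ler_sum => v vYX; rewrite leNgt; apply/negP => vl.
        by apply: noE; exists v.
      rewrite sumr_const -[leLHS]mulr_natr ler_wpM2l ?mulr_ge0 //.
      by rewrite ler_nat subset_leq_card ?subsetDl.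
    apply/negP; rewrite -ltNge exchange_big natr_sum /=.
    have -> : c * k%:R * #|Y|%:R = \sum_(x in X) (c * #|Y|%:R).
      by rewrite sumr_const Xk -[RHS]mulr_natr mulrAC.
    have /card_gt0P[x0 x0X] : (0 < #|X|)%N by rewrite Xk.
    apply: ltr_sum => [|x xX]; first by apply/hasP; exists x0; rewrite ?mem_index_enum.
    have xY := subsetP XY x xX.
    have star : (\sum_(y in X) pair_weight w x y <= q)%N.
      by apply: leq_trans (pair_weight_star w xX) (weight_small _ _); rewrite ?Xk 1?ltnW // (subset_trans XY).
    have hx := high x xY.
    have E : (\sum_(y in Y) pair_weight w x y = \sum_(y in X) pair_weight w x y +
              \sum_(y in Y :\: X) pair_weight w y x)%N.
      rewrite (big_setID X) (setIidPr XY) /=; congr addn.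
      by apply: eq_bigr => y _; rewrite pair_weightC.
    by move: hx star; rewrite E natrD -(ler_nat R); lra.
  exists (v |: X)%SET; split.
  - by rewrite subUset sub1set vY.
  - by rewrite cardsU1 vX Xk.
  rewrite weightU1 // big_nat_recr //= leq_add //.
  have := g_le (k := k); rewrite k_gt0 ks => /(_ isT) gk.
  by rewrite -ltnS -(ltr_nat R) -addn1 natrD; apply: le_lt_trans gk _; rewrite ltrD2r.
by apply: build; rewrite s_gt0 leqnn.
Qed.

(** Removing vertices of low degree one at a time shows that the average weight of the pairs
    is asymptotically at most $c$. *)
Lemma sparse_weight_le Y : Y \subset S ->
  (weight w Y)%:R <= c * (#|Y|%:R * (#|Y|%:R + 1) / 2) + q%:R * #|Y|%:R + q%:R.
Proof.
move: {2}#|Y| (erefl #|Y|) => m; elim: m Y => [|m IH] Y Ym YS.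
  rewrite Ym !(mul0r, mulr0) !add0r ler_nat; apply: weight_small => //.
  by rewrite Ym.
have [Ys|sY] := leqP #|Y| s.
  apply: (@le_trans _ _ q%:R); first by rewrite ler_nat weight_small.
  by rewrite lerDr addr_ge0 ?mulr_ge0 ?addr_ge0 ?invr_ge0.
have [v vY vd] := low_degree_vertex YS sY.
have Ym' : #|Y :\ v| = m.
  by have := cardsD1 v Y; rewrite vY Ym => -[].
have := IH _ Ym' (subset_trans (subD1set _ _) YS); rewrite Ym' => IHY.
have wE : weight w Y = (weight w (Y :\ v) + \sum_(y in Y :\ v) pair_weight w v y)%N.
  by rewrite -{1}(setD1K vY) weightU1 ?setD11.
move: vd; rewrite (big_setD1 v) //= pair_weightxx add0n wE natrD Ym -natr1 => vd.
lra.
Qed.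

End Extremal.

(** * Conditional averages on a finite probability space *)

Section CondAverage.
Variables (R : realType) (Om : finType).
Implicit Types (g h : Om -> R) (w : Om).

(** Conditional expectation of $g$ given the key $k$, for the uniform measure on [Om]:
    the average of $g$ over the fibre of $k$ through $w$. *)
Definition cond (K : eqType) (k : Om -> K) g w : R :=
  (\sum_(w' | k w' == k w) g w') / #|[pred w' | k w' == k w]|%:R.

(** The function $h$ is determined by the key $k$. *)
Definition measurable_wrt (K : eqType) (k : Om -> K) (T : Type) (h : Om -> T) :=
  forall w w', k w = k w' -> h w = h w'.

Section OneKey.
Variables (K : eqType) (k : Om -> K).

Lemma cond_measurable g : measurable_wrt k (cond k g).
Proof. by move=> w w' kw; rewrite /cond kw. Qed.

Lemma fibre_gt0 w : (0 < #|[pred w' | k w' == k w]|)%N.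
Proof. by apply/card_gt0P; exists w; rewrite inE. Qed.

(** Conditional expectation is self-adjoint on functions determined by the key. *)
Lemma cond_proj g h : measurable_wrt k h ->
  \sum_w cond k g w * h w = \sum_w g w * h w.
Proof.
move=> hk; under eq_bigr => w _ do rewrite /cond !mulr_suml.
rewrite (exchange_big_dep predT) //=; apply: eq_bigr => w' _.
rewrite (eq_bigr (fun _ => g w' * h w' / #|[pred w | k w == k w']|%:R)); last first.
  by move=> w /eqP kw; rewrite (hk _ _ kw) mulrAC kw.
rewrite (eq_bigl [in [pred w | k w == k w']]); last by move=> w; rewrite inE eq_sym.
rewrite sumr_const -[LHS]mulr_natr divfK //.
by rewrite pnatr_eq0 -lt0n fibre_gt0.
Qed.

Lemma cond_ge0 g w : (forall w, 0 <= g w) -> 0 <= cond k g w.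
Proof. by move=> g0; rewrite divr_ge0 ?sumr_ge0. Qed.

Lemma cond_sum (I : finType) (g : I -> Om -> R) w :
  \sum_i cond k (g i) w = cond k (fun w => \sum_i g i w) w.
Proof. by rewrite -mulr_suml exchange_big. Qed.

Lemma cond_const (a : R) w : cond k (fun=> a) w = a.
Proof.
rewrite /cond (eq_bigl [in [pred w' | k w' == k w]]) ?sumr_const //.
by rewrite -[a *+ _]mulr_natr mulfK // pnatr_eq0 -lt0n fibre_gt0.
Qed.

End OneKey.

(** When the key $l$ refines the key $k$, the average over $k$ is the orthogonal projection
    of the average over $l$. *)
Lemma cond_pythagoras (K L : eqType) (k : Om -> K) (l : Om -> L) g :
  measurable_wrt l k ->
  \sum_w (cond l g w - cond k g w) ^+ 2 =
  \sum_w cond l g w ^+ 2 - \sum_w cond k g w ^+ 2.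
Proof.
move=> lk.
have kl : measurable_wrt l (cond k g) by move=> w w' /lk; apply: cond_measurable.
have E : \sum_w cond l g w * cond k g w = \sum_w cond k g w ^+ 2.
  rewrite cond_proj // -(cond_proj (k := k)); last exact: cond_measurable.
  by apply: eq_bigr => w _; rewrite expr2.
under eq_bigr => w _ do rewrite sqrrB -mulr_natr.
by rewrite big_split sumrB -mulr_suml E /=; ring.
Qed.

Lemma ln_prod (I : Type) (r : seq I) (P : pred I) (G : I -> R) :
  (forall i, P i -> 0 < G i) ->
  ln (\prod_(i <- r | P i) G i) = \sum_(i <- r | P i) ln (G i).
Proof.
move=> G0; elim: r => [|i r IH]; first by rewrite !big_nil ln1.
rewrite !big_cons; case: ifP => // Pi.
by rewrite lnM ?IH ?posrE ?G0 // prodr_gt0.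
Qed.

(** Gibbs' inequality, in the form of an encoding bound: if every $w$ is given a positive
    share of a total budget $C$, then [ln #|Om|] is at most [ln C] plus the average length
    of the code words. *)
Lemma gibbs (rho : Om -> R) (C : R) : 0 < C -> (forall w, 0 < rho w) ->
  \sum_w rho w <= C ->
  #|Om|%:R * ln (#|Om|%:R : R) <= #|Om|%:R * ln C + \sum_w - ln (rho w).
Proof.
move=> C0 rho0 rhoC; have [Om0|Om0] := posnP #|Om|.
  by rewrite Om0 !mul0r add0r big1 // => w; have := fintype0 w; rewrite Om0.
have N0 : 0 < #|Om|%:R :> R by rewrite ltr0n.
have bound w : ln (rho w) + ln #|Om|%:R - ln C <= rho w * #|Om|%:R / C - 1.
  rewrite -lnM ?posrE // -ln_div ?posrE ?mulr_gt0 //.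
  rewrite -[X in ln X](subrK 1) [X in ln X]addrC; apply: le_ln1Dx.
  by rewrite ltrBDl addrN divr_gt0 ?mulr_gt0.
have : \sum_w (ln (rho w) + ln #|Om|%:R - ln C) <= 0.
  apply: le_trans (ler_sum _ (fun w _ => bound w)) _.
  rewrite sumrB sumr_const -mulr_suml -mulr_suml subr_le0.
  by rewrite ler_pdivrMr // mulrC ler_wpM2l.
rewrite sumrB big_split /= !sumr_const -[ln #|Om|%:R *+ _]mulr_natl.
rewrite -[ln C *+ _]mulr_natl sumrN; lra.
Qed.

End CondAverage.

(** A random array: the values $X(w)_e$, $e \in E$, of a uniformly distributed point $w$. *)
Section Array.
Variables (R : realType) (Om E : finType) (q : nat) (X : Om -> {ffun E -> 'I_q.+1}).
Implicit Types (A B : {set E}) (e : E) (w : Om) (c : 'I_q.+1).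
Local Notation Q := (q.+1%:R : R).
Local Notation N := (#|Om|%:R : R).

(** The values of the array on the coordinates in $A$, the others being set to $0$. *)
Definition key A w : {ffun E -> 'I_q.+1} := [ffun e => if e \in A then X w e else ord0].

Lemma keyP A w w' : key A w = key A w' <-> {in A, X w =1 X w'}.
Proof.
split=> [kk e eA|XX]; first by have := congr1 (fun f : {ffun _ -> _} => f e) kk; rewrite !ffunE eA.
by apply/ffunP => e; rewrite !ffunE; case: ifP => // /XX.
Qed.

Lemma keyS A B : A \subset B -> measurable_wrt (key B) (key A).
Proof.
move=> /subsetP AB w w' /keyP kB; apply/keyP => e /AB; exact: kB.
Qed.

(** Conditional probability, given the array on $A$, that the entry $e$ is $c$. *)
Definition prob A e c : Om -> R := cond (key A) (fun w => (X w e == c)%:R).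

(** The sum over $w$ and over the values $c$ of the squared conditional probabilities.
    Conditioning on more coordinates raises the energy, and the increment measures how
    far the entry $e$ is from being conditionally independent of the new coordinates. *)
Definition energy A e : R := \sum_c \sum_w prob A e c w ^+ 2.

Lemma prob_ge0 A e c w : 0 <= prob A e c w.
Proof. by apply: cond_ge0 => w'; rewrite ler0n. Qed.

Lemma prob_sum A e w : \sum_c prob A e c w = 1.
Proof.
rewrite cond_sum -[RHS](cond_const (key A) 1 w); congr (cond _ _ _).
by apply/funext => w'; rewrite -natr_sum (bigD1 (X w' e)) //= eqxx big1 // => c;
  rewrite eq_sym => /negPf->.
Qed.

Lemma prob_le1 A e c w : prob A e c w <= 1.
Proof.
rewrite -(prob_sum A e w) (bigD1 c) //= lerDl sumr_ge0 // => *; exact: prob_ge0.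
Qed.

Lemma energy_mono A B e : A \subset B -> energy A e <= energy B e.
Proof.
move=> AB; apply: ler_sum => c _; rewrite -subr_ge0 -cond_pythagoras; last exact: keyS.
by apply: sumr_ge0 => w _; rewrite sqr_ge0.
Qed.

Lemma energy_ge0 A e : 0 <= energy A e.
Proof. by rewrite sumr_ge0 // => c _; rewrite sumr_ge0 // => w _; rewrite sqr_ge0. Qed.

Lemma energy_le A e : energy A e <= N.
Proof.
rewrite /energy exchange_big /= -sumr_const; apply: ler_sum => w _.
rewrite -(prob_sum A e w); apply: ler_sum => c _.
by rewrite expr2 ler_piMl ?prob_ge0 ?prob_le1.
Qed.

(** Summing over the value of [X w e] trades the entry for its conditional law. *)
Lemma sum_entry A e (G : 'I_q.+1 -> Om -> R) :
  (forall c, measurable_wrt (key A) (G c)) ->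
  \sum_w G (X w e) w = \sum_w \sum_c G c w * prob A e c w.
Proof.
move=> Gm; rewrite [RHS]exchange_big /=.
transitivity (\sum_c \sum_w G c w * (X w e == c)%:R).
  rewrite exchange_big /=; apply: eq_bigr => w _.
  rewrite (bigD1 (X w e)) //= eqxx mulr1 big1 ?addr0 // => c.
  by rewrite eq_sym => /negPf->; rewrite mulr0.
apply: eq_bigr => c _; under [RHS]eq_bigr do rewrite mulrC.
by rewrite cond_proj; [apply: eq_bigr => w _; rewrite mulrC | exact: Gm].
Qed.

(** If $B$ carries little more energy than $A$, the entry $e$ can be replaced by its
    conditional law given $A$ even against functions of the array on $B$. The $L^1$ distance
    of the two conditional laws is bounded through $|x| \le x^2/d + d$. *)
Lemma entry_decouple A B e (h : Om -> R) (m : Om -> 'I_q.+1) (d : R) :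
  A \subset B -> 0 < d ->
  measurable_wrt (key B) h -> (forall w, 0 <= h w <= 1) ->
  measurable_wrt (key A) m ->
  `|\sum_w h w * (X w e == m w)%:R - \sum_w h w * prob A e (m w) w|
     <= (energy B e - energy A e) / d + Q * d * N.
Proof.
move=> AB d0 hB h01 mA.
have mB : measurable_wrt (key B) m by move=> w w' /(keyS AB); apply: mA.
rewrite (@sum_entry B e (fun c w => h w * (c == m w)%:R)); last first.
  by move=> c w w' kw; rewrite (hB _ _ kw) (mB _ _ kw).
have -> : \sum_w h w * prob A e (m w) w =
    \sum_w \sum_c h w * (c == m w)%:R * prob A e c w.
  apply: eq_bigr => w _; rewrite (bigD1 (m w)) //= eqxx mulr1 big1 ?addr0 // => c.
  by move=> /negPf->; rewrite mulr0 mul0r.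
rewrite -sumrB; under eq_bigr do rewrite -sumrB.
have -> : (energy B e - energy A e) / d + Q * d * N =
    \sum_w \sum_c ((prob B e c w - prob A e c w) ^+ 2 / d + d).
  under [RHS]eq_bigr do rewrite big_split sumr_const card_ord /=.
  rewrite big_split sumr_const /= exchange_big /=; congr (_ + _).
    under [RHS]eq_bigr do rewrite -mulr_suml.
    rewrite -mulr_suml /energy -sumrB; congr (_ / _); apply: eq_bigr => c _.
    by rewrite /prob cond_pythagoras //; apply: keyS.
  by rewrite -[RHS]mulr_natr -[d *+ _]mulr_natl.
apply: le_trans (ler_norm_sum _ _ _) _; apply: ler_sum => w _.
apply: le_trans (ler_norm_sum _ _ _) _; apply: ler_sum => c _.
rewrite -mulrBr; set x := prob _ _ _ _ - _.
have /andP[h0 h1] := h01 w.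
apply: (@le_trans _ _ `|x|).
  rewrite normrM ler_piMl // ger0_norm ?mulr_ge0 //.
  by case: (c == m w); rewrite ?mulr1 ?mulr0.
have [xd|dx] := leP `|x| d.
  by apply: le_trans xd _; rewrite lerDr divr_ge0 ?sqr_ge0 // ltW.
apply: (@le_trans _ _ (x ^+ 2 / d)); last by rewrite lerDl ltW.
rewrite ler_pdivlMr // -[x ^+ 2]ger0_norm ?sqr_ge0 // normrX expr2.
by rewrite ler_wpM2l // ltW.
Qed.

Lemma prob_measurable A e c : measurable_wrt (key A) (prob A e c).
Proof. exact: cond_measurable. Qed.

(** The entry is replaced by its conditional law one coordinate at a time. *)
Lemma seq_decouple A (es : seq E) (h : Om -> R) (m : E -> Om -> 'I_q.+1) (d gam : R) :
  uniq es -> 0 < d -> {in es, forall e B, A \subset B ->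
    B \subset A :|: [set e' in es | e' != e] -> energy B e - energy A e <= gam * N} ->
  measurable_wrt (key A) h -> (forall w, 0 <= h w <= 1) ->
  (forall e, measurable_wrt (key A) (m e)) ->
  `|\sum_w h w * \prod_(e <- es) (X w e == m e w)%:R
     - \sum_w h w * \prod_(e <- es) prob A e (m e w) w|
     <= (size es)%:R * ((gam / d + Q * d) * N).
Proof.
move=> + d0 + + + mA; elim: es h => [|e es IH] h /= es_uniq en hA h01.
  by under eq_bigr do rewrite big_nil; under [in X in _ - X]eq_bigr do rewrite big_nil;
     rewrite subrr normr0 mul0r.
case/andP: es_uniq => e_es es_uniq.
have ind01 w : 0 <= \prod_(e <- es) ((X w e == m e w)%:R : R) <= 1.
  rewrite prodr_ge0 ?prodr_ile1 //= => e' _; rewrite ?ler0n //.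
  by case: (_ == _); rewrite ?lexx ?ler01.
under eq_bigr do rewrite big_cons mulrCA mulrC.
under [in X in _ - X]eq_bigr do rewrite big_cons mulrA.
pose B := A :|: [set e' in es].
have eB := @entry_decouple A B e (fun w => h w * \prod_(e <- es) (X w e == m e w)%:R) (m e) d
  (subsetUl _ _) d0.
rewrite -natr1 mulrDl mul1r [leRHS]addrC.
apply: le_trans (ler_distD
  (\sum_w h w * \prod_(e0 <- es) (X w e0 == m e0 w)%:R * prob A e (m e w) w) _ _) _.
apply: lerD.
  apply: le_trans (eB _ _ (mA e)) _.
  - move=> w w' kw; have kAw := keyS (subsetUl _ _) kw.
    rewrite (hA _ _ kAw); congr (_ * _); apply: eq_big_seq => e' e'es.
    rewrite (mA _ _ _ kAw); move/keyP: kw => -> //.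
    by rewrite !inE e'es orbT.
  - move=> w; have /andP[h0 h1] := h01 w; have /andP[i0 i1] := ind01 w.
    by rewrite mulr_ge0 //= mulr_ile1.
  rewrite [leRHS]mulrDl lerD2r mulrAC ler_pM2r ?invr_gt0 //.
  apply: en; rewrite ?inE ?eqxx ?subsetUl //.
  rewrite setUS //; apply/subsetP => e'; rewrite !inE => e'es.
  by rewrite e'es orbT; apply: contraNneq e_es => <-.
under [X in `|X - _|]eq_bigr do rewrite mulrAC.
apply: IH => //.
- move=> e' e'es C AC Csub; apply: en => //; first by rewrite inE e'es orbT.
  apply: subset_trans Csub (setUS _ _); apply/subsetP => e''.
  by rewrite !inE => /andP[-> ->]; rewrite orbT.
- move=> w w' kw; rewrite (hA _ _ kw) (mA _ _ _ kw).
  by rewrite (prob_measurable _ _ kw).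
- move=> w; have /andP[h0 h1] := h01 w.
  by rewrite mulr_ge0 ?prob_ge0 //= mulr_ile1 ?prob_ge0 ?prob_le1.
Qed.

(** If $m$ takes values of conditional probability at least [eta] on the nearly independent
    entries [es], then the configuration $m$ is rarely impossible. *)
Lemma impossible_rare A (es : seq E) (m : E -> Om -> 'I_q.+1) (d gam eta : R) (P : pred Om) :
  uniq es -> 0 < d -> {in es, forall e B, A \subset B ->
    B \subset A :|: [set e' in es | e' != e] -> energy B e - energy A e <= gam * N} ->
  (forall e, measurable_wrt (key A) (m e)) -> measurable_wrt (key A) P ->
  0 <= eta -> (forall e w, eta <= prob A e (m e w) w) ->
  (forall w, P w -> exists2 e, e \in es & X w e != m e w) ->
  #|P|%:R * eta ^+ size es <= (size es)%:R * ((gam / d + Q * d) * N).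
Proof.
move=> es_uniq d0 en mA PA eta0 meta Pm.
have := seq_decouple (h := fun w => (P w)%:R) es_uniq d0 en _ _ mA.
rewrite big1 => [|w _]; last first.
  case Pw: (P w); last by rewrite mul0r.
  have [e ees /negPf Xe] := Pm w Pw; rewrite mul1r.
  by rewrite (big_rem e) //= Xe mul0r.
rewrite sub0r normrN => H; apply: le_trans _ (H _ _); last 2 first.
- by move=> w w' kw; rewrite (PA _ _ kw).
- by move=> w; case: (P w); rewrite ?ler01 ?lexx.
apply: le_trans (ler_norm _).
rewrite mulr_natl -sumr_const [leLHS]big_mkcond /=; apply: ler_sum => w _.
rewrite unfold_in; case: (P w); rewrite ?mul0r // mul1r.
have -> : eta ^+ size es = \prod_(e <- es) eta by rewrite big_const_seq count_predT -Monoid.iteropE.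
rewrite big_seq [leRHS]big_seq; apply: ler_prod => e _.
by rewrite eta0 meta.
Qed.

(** The largest value whose conditional probability is at least [eta] ($0$ if there is none,
    which does not happen for [eta * (q + 1) <= 1]). *)
Definition mode (eta : R) A e w : 'I_q.+1 :=
  inord (\max_(c : 'I_q.+1 | eta <= prob A e c w) c).

Lemma mode_measurable eta A e : measurable_wrt (key A) (mode eta A e).
Proof.
move=> w w' kw; rewrite /mode; congr inord; apply: eq_bigl => c.
by rewrite (prob_measurable _ _ kw).
Qed.

Lemma val_mode eta A e w :
  mode eta A e w = \max_(c : 'I_q.+1 | eta <= prob A e c w) c :> nat.
Proof. by rewrite inordK // ltnS; apply/bigmax_leqP => c _; rewrite -ltnS. Qed.

Lemma prob_mode eta A e w : eta * Q <= 1 -> eta <= prob A e (mode eta A e w) w.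
Proof.
move=> etaQ; have [|c cP cE] := @eq_bigmax_cond _ [pred c | eta <= prob A e c w] (@nat_of_ord q.+1).
  apply/card_gt0P; apply: contrapT => no.
  have small c : prob A e c w < eta.
    by rewrite ltNge; apply/negP => cP; apply: no; exists c.
  have : \sum_c prob A e c w < \sum_(c : 'I_q.+1) eta.
    apply: ltr_sum => [|c _]; last exact: small.
    by apply/hasP; exists ord0; rewrite ?mem_index_enum.
  by rewrite prob_sum sumr_const card_ord -mulr_natr ltNge etaQ.
suff -> : mode eta A e w = c by [].
by apply: val_inj; rewrite /= val_mode.
Qed.

(** Entries seldom exceed their mode: each larger value has conditional probability below
    [eta]. *)
Lemma overflow eta A e : 0 <= eta ->
  \sum_w ((mode eta A e w < X w e)%N)%:R <= Q * eta * N.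
Proof.
move=> eta0.
rewrite (@sum_entry A e (fun c w => ((mode eta A e w < c)%N)%:R)); last first.
  by move=> c w w' kw; rewrite (mode_measurable _ _ kw).
rewrite [leRHS]mulr_natr -sumr_const; apply: ler_sum => w _.
rewrite mulr_natl -[in leRHS](card_ord q.+1) -sumr_const; apply: ler_sum => c _.
case: ltnP; rewrite ?mul0r // mul1r => lt; rewrite leNgt; apply/negP => etac.
suff: (c <= mode eta A e w)%N by rewrite leqNgt lt.
by rewrite val_mode (leq_bigmax_cond (P := fun c : 'I__ => _ <= prob A e c w)) // ltW.
Qed.

(** A code adapted to the prediction that the entry is at most [m]: almost all the budget is
    spread evenly over the values up to [m]. *)
Definition code (kap : R) (m c : 'I_q.+1) : R :=
  if (c <= m)%N then (1 - kap) / m.+1%:R else kap / Q.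

Lemma code_gt0 kap m c : 0 < kap < 1 -> 0 < code kap m c.
Proof.
by case/andP=> k0 k1; rewrite /code; case: ifP => _; rewrite divr_gt0 ?subr_gt0 ?ltr0n.
Qed.

Lemma code_sum kap m : 0 < kap < 1 -> \sum_c code kap m c <= 1.
Proof.
case/andP=> k0 k1; rewrite (bigID (fun c : 'I_q.+1 => (c < m.+1)%N)) /=.
rewrite (eq_bigr (fun=> (1 - kap) / m.+1%:R)) => [|c cm]; last first.
  by move: cm; rewrite ltnS /code => ->.
rewrite -(big_ord_widen q.+1 (fun=> (1 - kap) / m.+1%:R) (ltn_ord m)).
rewrite sumr_const card_ord -[_ *+ m.+1]mulr_natr divfK ?pnatr_eq0 //.
suff : \sum_(c < q.+1 | ~~ (c < m.+1)%N) code kap m c <= kap by lra.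
apply: (@le_trans _ _ (\sum_(c < q.+1) kap / Q)); last first.
  by rewrite sumr_const card_ord -[_ *+ q.+1]mulr_natr divfK ?pnatr_eq0.
rewrite [leLHS]big_mkcond; apply: ler_sum => c _; rewrite /code ltnS.
by case: (leqP c m) => //= _; rewrite divr_ge0 ?ltW.
Qed.

Lemma ln_code kap m c : 0 < kap < 1 ->
  - ln (code kap m c) <=
    ln m.+1%:R - ln (1 - kap) + ((m < c)%N)%:R * ln (Q / kap).
Proof.
case/andP=> k0 k1; have k1' : 0 < 1 - kap by rewrite subr_gt0.
have Lk : ln (1 - kap) <= 0 by rewrite ln_le0 // gerBl ltW.
have Lm : 0 <= ln (m.+1%:R : R) by rewrite ln_ge0 // ler1n.
rewrite /code; case: leqP => mc.
  by rewrite mul0r addr0 ln_div ?posrE ?ltr0n // opprB.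
rewrite mul1r !ln_div ?posrE ?ltr0n //; lra.
Qed.

Lemma card_key_image A : (#|[set key A w | w in Om]| <= q.+1 ^ #|A|)%N.
Proof.
rewrite -[q.+1 in leqRHS]card_ord -(card_pffun_on ord0 (mem A) predT).
apply: subset_leq_card; apply/subsetP => _ /imsetP[w _ ->].
apply/pffun_onP; split=> //; apply/subsetP => e; rewrite inE ffunE.
by case: ifP => //; rewrite eqxx.
Qed.

(** Encode first the entries in $A$, at full cost, then each other entry with the code
    adapted to the prediction [m], which the entries in $A$ determine. *)
Lemma encoding A kap (m : E -> Om -> 'I_q.+1) : injective X -> 0 < kap < 1 ->
  (forall e, measurable_wrt (key A) (m e)) ->
  N * ln N <= N * (#|A|%:R * ln Q) +
    \sum_w \sum_(e | e \notin A) - ln (code kap (m e w) (X w e)).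
Proof.
move=> Xinj kap01 mA.
pose F w e c := if e \in A then 1 else code kap (m e w) c.
have F0 w e c : 0 < F w e c by rewrite /F; case: ifP => // _; exact: code_gt0.
pose rho w := \prod_e F w e (X w e).
have rho0 w : 0 < rho w by apply: prodr_gt0.
have fibre k : \sum_(w | key A w == k) rho w <= 1.
  have [[w0 kw0]|no] := pselect (exists w0, key A w0 = k); last first.
    by rewrite big1 // => w /eqP kw; case: no; exists w.
  rewrite (eq_bigr (fun w => \prod_e F w0 e (X w e))); last first.
    move=> w /eqP kw; apply: eq_bigr => e _; rewrite /F; case: ifP => // _.
    by rewrite (mA e w w0) // kw.
  rewrite (eq_bigl [in [set w | key A w == k]]); last by move=> w; rewrite inE.
  rewrite -(big_imset (fun x : {ffun E -> 'I_q.+1} => \prod_e F w0 e (x e))) /=;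
    last by move=> ? ? _ _; apply: Xinj.
  pose P e := if e \in A then pred1 (X w0 e) else predT.
  apply: (@le_trans _ _ (\prod_e \sum_(c | P e c) F w0 e c)).
    rewrite bigA_distr_big_dep [leLHS]big_mkcond [leRHS]big_mkcond /=.
    apply: ler_sum => x _; case: ifP => [/imsetP[w]|_]; last first.
      by case: ifP => // _; apply: prodr_ge0 => e _; apply: ltW.
    rewrite inE => /eqP kw ->; rewrite ifT //.
    apply/familyP => e; rewrite /P unfold_in; case: ifP => //= eA.
    by apply/eqP; move: kw; rewrite -kw0 => /keyP->.
  apply: prodr_ile1 => e _; rewrite sumr_ge0 /= => [|c _]; last exact: ltW.
  rewrite /P /F; case: ifP => _; first by rewrite (big_pred1 (X w0 e)).
  exact: code_sum.
have rho_sum : \sum_w rho w <= Q ^+ #|A|.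
  rewrite (partition_big (key A) [in [set key A w | w in Om]]) /=; last first.
    by move=> w _; apply: imset_f.
  apply: le_trans (ler_sum _ (fun k _ => fibre k)) _.
  by rewrite sumr_const -natrX ler_nat card_key_image.
have Q0 : 0 < Q ^+ #|A| by rewrite exprn_gt0 ?ltr0n.
have := gibbs Q0 rho0; rewrite lnXn ?ltr0n // -[ln Q *+ _]mulr_natl => H.
apply: le_trans (H rho_sum) _.
rewrite lerD2l; apply: ler_sum => w _.
rewrite /rho (bigID [in A]) /= big1 ?mul1r => [|e eA]; last by rewrite /F eA.
rewrite sumrN ln_prod => [|e _]; last exact: F0.
by rewrite lerN2 le_eqVlt; apply/orP; left; apply/eqP/eq_bigr => e /negPf eA; rewrite /F eA.
Qed.

End Array.

(** * Exchangeability *)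

(** Permutations act transitively on pairs of disjoint sets of given sizes. *)
Lemma exists_perm_imset (V : finType) (T U T' U' : {set V}) :
  [disjoint T & U] -> [disjoint T' & U'] -> #|T| = #|T'| -> #|U| = #|U'| ->
  exists sigma : {perm V}, sigma @: T = T' /\ sigma @: U = U'.
Proof.
move=> dTU dTU' cT cU.
pose s (A B : {set V}) := enum A ++ enum B ++ enum (~: (A :|: B)).
have s_uniq (A B : {set V}) : [disjoint A & B] -> uniq (s A B).
  move=> dAB; rewrite /s !cat_uniq !enum_uniq !andbT /=; apply/andP; split.
  - apply/hasPn => x; rewrite mem_cat !mem_enum !inE.
    case/orP => [xB|]; last by rewrite negb_or => /andP[].
    by apply: contraTN xB => xA; rewrite (disjointFr dAB xA).
  - by apply/hasPn => x; rewrite !mem_enum !inE negb_or => /andP[].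
have s_mem (A B : {set V}) x : x \in s A B.
  rewrite !mem_cat !mem_enum !inE.
  by case: (x \in A) => //; case: (x \in B).
have s_size (A B : {set V}) : [disjoint A & B] -> size (s A B) = #|V|.
  by move=> d; rewrite -(card_uniqP (s_uniq _ _ d)); apply: eq_card => x; rewrite s_mem inE.
have [v0 _|noV] := pickP (@predT V); last first.
  by exists 1%g; split; apply/setP => x; have := noV x.
pose f x := nth v0 (s T' U') (index x (s T U)).
have idx x : (index x (s T U) < size (s T' U'))%N.
  by rewrite s_size // -(s_size _ _ dTU) index_mem s_mem.
have f_inj : injective f.
  move=> x y /eqP; rewrite /f nth_uniq ?s_uniq ?idx // => /eqP E.
  by rewrite -(nth_index v0 (s_mem T U x)) E nth_index ?s_mem.
have im (A A' : {set V}) : #|A| = #|A'| -> {in A, forall x, f x \in A'} ->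
    perm f_inj @: A = A'.
  move=> cA fA; apply/eqP; rewrite eqEcard card_imset ?cA ?leqnn ?andbT; last exact: perm_inj.
  by apply/subsetP => _ /imsetP[x xA ->]; rewrite permE fA.
exists (perm f_inj); split; apply: im => // x xA; rewrite /f /s.
- rewrite index_cat mem_enum xA nth_cat.
  have lt : (index x (enum T) < size (enum T'))%N.
    by rewrite -cardE -cT cardE index_mem mem_enum.
  by rewrite lt -mem_enum mem_nth.
- have xT : x \notin T by apply/negP => xT; have := disjointFr dTU xT; rewrite xA.
  rewrite index_cat mem_enum (negPf xT) index_cat mem_enum xA nth_cat.
  rewrite -!cardE cT ltnNge leq_addr /= addKn nth_cat.
  have lt : (index x (enum U) < size (enum U'))%N.
    by rewrite -cardE -cU cardE index_mem mem_enum.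
  by rewrite lt -mem_enum mem_nth.
Qed.

Section PermPair.
Variable V : finType.
Implicit Types (sigma : {perm V}) (e : pairs V) (T X : {set V}).

Lemma card_pair e : #|val e| = 2%N.
Proof. by apply/eqP; exact: (valP e). Qed.

Fact perm_pair_subproof sigma e : #|sigma @: val e| == 2%N.
Proof. by rewrite card_imset ?card_pair //; apply: perm_inj. Qed.

(** The action of a permutation of the vertices on the pairs. *)
Definition perm_pair sigma e : pairs V := Sub (sigma @: val e) (perm_pair_subproof sigma e).

Lemma val_perm_pair sigma e : val (perm_pair sigma e) = sigma @: val e.
Proof. by rewrite SubK. Qed.

Lemma perm_pairK sigma : cancel (perm_pair sigma) (perm_pair sigma^-1%g).
Proof.
move=> e; apply: val_inj; rewrite !val_perm_pair -imset_comp -[RHS]imset_id.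
by apply: eq_imset => x /=; rewrite permK.
Qed.

Lemma perm_pairKV sigma : cancel (perm_pair sigma^-1%g) (perm_pair sigma).
Proof. by move=> e; rewrite -{1}[sigma]invgK perm_pairK. Qed.

Lemma weight_perm (w : multigraph V) sigma X :
  weight [ffun e => w (perm_pair sigma e)] X = weight w (sigma @: X).
Proof.
rewrite /weight [RHS](reindex (perm_pair sigma)) /=; last first.
  by exists (perm_pair sigma^-1%g) => e _; rewrite ?perm_pairK ?perm_pairKV.
apply: eq_big => [e|e _]; last by rewrite ffunE.
apply/idP/idP; first exact: imsetS.
move=> /subsetP sub; apply/subsetP => x xe.
by have := sub (sigma x) (imset_f _ xe); rewrite mem_imset //; apply: perm_inj.
Qed.

(** The pairs meeting $T$. *)
Definition touching T : {set pairs V} := [set e : pairs V | ~~ [disjoint val e & T]].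

Lemma touchingS T T' : T \subset T' -> touching T \subset touching T'.
Proof.
move=> sub; apply/subsetP => e; rewrite !inE; apply: contra.
by move=> dT'; rewrite (disjointWr sub).
Qed.

Lemma touching_perm sigma T e :
  (perm_pair sigma e \in touching (sigma @: T)) = (e \in touching T).
Proof.
rewrite !inE; congr (~~ _); rewrite -!setI_eq0 val_perm_pair -imsetI.
  by rewrite imset_eq0.
by move=> x y _ _; apply: perm_inj.
Qed.

Lemma card_touching T : (#|touching T| <= #|T| * #|V|)%N.
Proof.
rewrite -cardsT -cardsX -(card_imset _ val_inj).
apply: leq_trans (leq_imset_card (fun p : V * V => [set p.1; p.2]) _).
apply: subset_leq_card; apply/subsetP => _ /imsetP[e + ->].
rewrite inE -setI_eq0 => /set0Pn[x /setIP[xe xT]].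
have [y _ ->] := pair_other xe; apply/imsetP; exists (x, y) => //.
by rewrite !inE xT.
Qed.

Lemma card_pairs : #|{: pairs V}| = 'C(#|V|, 2).
Proof. by rewrite card_sig -card_draws; apply: eq_card => e; rewrite !inE. Qed.

(** The pairs contained in $X$. *)
Definition inner_pairs X : seq (pairs V) := enum [pred e : pairs V | val e \subset X].

Lemma size_inner_pairs X : size (inner_pairs X) = 'C(#|X|, 2).
Proof.
rewrite -cardE -cards_draws -(card_imset _ val_inj); apply: eq_card => A.
rewrite inE; apply/imsetP/andP => [[e]|[AX A2]]; first by rewrite inE => eX ->; split=> //; exact: (valP e).
by exists (Sub A A2); rewrite ?inE ?SubK.
Qed.

End PermPair.

Section SparseArrays.
Variables (R : realType) (V : finType) (s q : nat).
Implicit Types (x : {ffun pairs V -> 'I_q.+1}) (T X : {set V}) (e : pairs V).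

Definition bounded_multigraph x : multigraph V := [ffun e => x e : nat].

Definition sparse x :=
  [forall X : {set V}, (#|X| == s) ==> (weight (bounded_multigraph x) X <= q)%N].

(** The multigraphs with weights at most $q$ in which every $s$ vertices have total weight at
    most $q$; for $2 \le s \le n$ the bound on the single weights is automatic. *)
Definition sparse_array := {x | sparse x}.

Definition entries : sparse_array -> {ffun pairs V -> 'I_q.+1} := val.

Lemma sparse_perm (sigma : {perm V}) x :
  sparse x -> sparse [ffun e => x (perm_pair sigma e)].
Proof.
move=> /forallP xs; apply/forallP => X; apply/implyP => /eqP Xs.
have := xs (sigma @: X); rewrite card_imset ?Xs ?eqxx -?weight_perm /=; last exact: perm_inj.
by congr (_ <= _)%N; apply: eq_bigr => e _; rewrite !ffunE.
Qed.

(** Relabelling the vertices. *)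
Definition perm_array (sigma : {perm V}) (w : sparse_array) : sparse_array :=
  Sub _ (sparse_perm sigma (valP w)).

Lemma perm_arrayE sigma w e : entries (perm_array sigma w) e = entries w (perm_pair sigma e).
Proof. by rewrite /entries SubK ffunE. Qed.

Lemma perm_arrayK sigma : cancel (perm_array sigma) (perm_array sigma^-1%g).
Proof.
by move=> w; apply/val_inj/ffunP => e; rewrite [LHS]perm_arrayE perm_arrayE perm_pairKV.
Qed.

Lemma perm_array_bij sigma : bijective (perm_array sigma).
Proof.
exists (perm_array sigma^-1%g); first exact: perm_arrayK.
by move=> w; rewrite -{1}[sigma]invgK perm_arrayK.
Qed.

Local Notation prob := (prob R entries).
Local Notation energy := (energy R entries).

Lemma key_perm sigma T w w' :
  (key entries (touching T) (perm_array sigma w) ==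
   key entries (touching T) (perm_array sigma w')) =
  (key entries (touching (sigma @: T)) w == key entries (touching (sigma @: T)) w').
Proof.
apply/eqP/eqP => /keyP kw; apply/keyP => e eT.
  have := kw (perm_pair sigma^-1%g e); rewrite !perm_arrayE perm_pairKV; apply.
  by rewrite -(touching_perm sigma) perm_pairKV.
by rewrite !perm_arrayE kw ?touching_perm.
Qed.

Lemma prob_perm sigma T e c w :
  prob (touching T) e c (perm_array sigma w) =
  prob (touching (sigma @: T)) (perm_pair sigma e) c w.
Proof.
rewrite /prob /cond; congr (_ / _%:R).
  rewrite (reindex (perm_array sigma)) /=; last exact/onW_bij/perm_array_bij.
  by apply: eq_big => [w'|w' _]; rewrite ?key_perm ?perm_arrayE.
rewrite -!sum1_card (reindex (perm_array sigma)) /=; last exact/onW_bij/perm_array_bij.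
by apply: eq_bigl => w'; rewrite !inE key_perm.
Qed.

(** The joint law of the conditional probabilities of the values of a pair $e$ given the
    pairs meeting $T$, for $e$ disjoint from $T$, only depends on $|T|$. *)
Lemma exchangeable (G : ('I_q.+1 -> R) -> R) T T' e e' :
  [disjoint T & val e] -> [disjoint T' & val e'] -> #|T| = #|T'| ->
  \sum_w G (fun c => prob (touching T) e c w) =
  \sum_w G (fun c => prob (touching T') e' c w).
Proof.
move=> dT dT' cT.
have [|sigma [sT se]] := exists_perm_imset dT dT' cT; first by rewrite !card_pair.
rewrite (reindex (perm_array sigma)) /=; last exact/onW_bij/perm_array_bij.
apply: eq_bigr => w _; congr G; apply/funext => c.
rewrite prob_perm sT; congr (prob _ _ _ _); apply: val_inj.
by rewrite val_perm_pair.
Qed.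

Lemma energy_exchangeable T T' e e' :
  [disjoint T & val e] -> [disjoint T' & val e'] -> #|T| = #|T'| ->
  energy (touching T) e = energy (touching T') e'.
Proof.
move=> dT dT' cT; rewrite /energy exchange_big [RHS]exchange_big /=.
exact: (exchangeable (fun p => \sum_c p c ^+ 2)).
Qed.

Lemma mode_exchangeable (eta : R) (G : nat -> R) T T' e e' :
  [disjoint T & val e] -> [disjoint T' & val e'] -> #|T| = #|T'| ->
  \sum_w G (mode entries eta (touching T) e w) =
  \sum_w G (mode entries eta (touching T') e' w).
Proof.
move=> dT dT' cT; under eq_bigr do rewrite val_mode; under [RHS]eq_bigr do rewrite val_mode.
exact: (exchangeable (fun p => G (\big[maxn/0%N]_(c : 'I_q.+1 | eta <= p c) c))).
Qed.

End SparseArrays.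

(** * The counting bound *)

(** By concavity, [ln (m + 1)] lies below the chord through the integers $a$ and $a + 1$; this
    turns a bound on the sum of the weights into a bound on the product of the $w(e)+1$. *)
Lemma ln_chord (R : realType) (a m : nat) :
  ln (m.+1%:R : R) <= ln a.+1%:R + (m%:R - a%:R) * ln (a.+2%:R / a.+1%:R).
Proof.
pose L k : R := ln k.+1%:R.
have lnE k : ln (k.+2%:R / k.+1%:R : R) = L k.+1 - L k by rewrite ln_div ?posrE ?ltr0n.
have dec i j : (i <= j)%N -> L j.+1 - L j <= L i.+1 - L i.
  move=> ij; rewrite -!lnE ler_ln ?posrE ?divr_gt0 ?ltr0n //.
  rewrite ler_pdivrMr ?ltr0n // mulrAC ler_pdivlMr ?ltr0n // -!natrM ler_nat; nia.
rewrite -/(L m) -/(L a) lnE.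
have [am|/ltnW ma] := leqP a m.
  rewrite -(subnKC am); elim: (m - a)%N => [|k IH]; first by rewrite addn0 subrr mul0r addr0.
  by have := dec a (a + k)%N (leq_addr _ _); move: IH; rewrite addnS -natr1; lra.
have up k : (k <= a)%N -> L (a - k)%N <= L a - k%:R * (L a.+1 - L a).
  elim: k => [|k IH] ka; first by rewrite subn0 mul0r subr0.
  have := dec (a - k.+1)%N a (leq_subr _ _); have := IH (ltnW ka).
  by rewrite -subSn // subSS -natr1; lra.
have := up (a - m)%N (leq_subr _ _); rewrite subKn // natrB //; lra.
Qed.

Lemma pigeonhole_increment (R : realType) (f : nat -> R) (J : nat) (N : R) :
  (0 < J)%N -> 0 <= f 0%N -> f J <= N ->
  exists2 j, (j < J)%N & f j.+1 - f j <= N / J%:R.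
Proof.
move=> J0 f0 fJ; apply: contrapT => no.
have big_step j : (j < J)%N -> N / J%:R < f j.+1 - f j.
  by move=> jJ; rewrite ltNge; apply/negP => le; apply: no; exists j.
have : \sum_(0 <= j < J) (N / J%:R) < \sum_(0 <= j < J) (f j.+1 - f j).
  rewrite !big_mkord; apply: ltr_sum => [|j _]; last exact: big_step.
  by apply/hasP; exists (Ordinal J0); rewrite ?mem_index_enum.
rewrite telescope_sumr // sumr_const_nat subn0 -[_ *+ J]mulr_natr divfK ?pnatr_eq0 -?lt0n //.
lra.
Qed.

(** The vertices $lo, \dots, hi - 1$. *)
Definition block (n lo hi : nat) : {set 'I_n} := [set x : 'I_n | lo <= x < hi]%N.

Lemma card_block n lo hi : (hi <= n)%N -> #|block n lo hi| = (hi - lo)%N.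
Proof.
move=> hn; rewrite -sum1_card /block.
under eq_bigl do rewrite inE.
rewrite -(big_mkord (fun i => lo <= i < hi)%N (fun=> 1%N)).
rewrite -(big_nat_widen 0 hi n (fun i => lo <= i)%N) // -(big_nat_widenl lo 0 hi predT) //.
by rewrite sum_nat_const_nat muln1.
Qed.

Lemma disjoint_block n lo hi lo' hi' : (hi <= lo')%N ->
  [disjoint block n lo hi & block n lo' hi'].
Proof.
move=> hl; rewrite -setI_eq0; apply/eqP/setP => x; rewrite !inE; apply/negP; lia.
Qed.

Lemma natr_bin2 (R : realFieldType) n : 'C(n, 2)%:R = n%:R * (n%:R - 1) / 2 :> R.
Proof.
case: n => [|n]; first by rewrite mul0r mul0r.
have : (2 * 'C(n.+1, 2) = n.+1 * n)%N by rewrite -mul_bin_diag bin1.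
by move/(congr1 (fun k => k%:R : R)); rewrite !natrM -[n.+1%:R]natr1 => H; nra.
Qed.

(** The parameters of the argument: $n_0$ is the size of the sampled vertex sets, $J$ the
    number of steps of the pigeonhole argument, [kap] the share of the code reserved to
    exceptional weights, [eta] the threshold for likely weights and [d] the scale at which
    conditional laws are compared. *)
Section CountingBound.
Variables (R : realType) (n s q a : nat) (theta : R) (g : nat -> nat).
Let c : R := a%:R + theta.
Hypothesis s_gt0 : (0 < s)%N.
Hypothesis theta_ge0 : 0 <= theta.
Hypothesis g_le : forall k, (0 < k < s)%N -> (g k)%:R <= c * k%:R + 1.
Hypothesis g_sum : (q < \sum_(1 <= k < s) g k)%N.
Variables (n0 J : nat) (kap eta d : R).
Hypothesis s_le_n0 : (s <= n0)%N.
Hypothesis n0_gt1 : (1 < n0)%N.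
Hypothesis J_gt0 : (0 < J)%N.
Hypothesis n_large : (J * n0 + 2 <= n)%N.
Hypothesis kap01 : 0 < kap < 1.
Hypothesis eta_gt0 : 0 < eta.
Hypothesis eta_le : eta * q.+1%:R <= 1.
Hypothesis d_gt0 : 0 < d.

Local Notation Om := (sparse_array 'I_n s q).
Local Notation X := (@entries 'I_n s q).
Local Notation N := (#|{: Om}|%:R : R).
Local Notation Q := (q.+1%:R : R).
Local Notation rho := (a.+2%:R / a.+1%:R : R).
Local Notation lambda := (ln a.+1%:R + theta * ln rho).
Local Notation M := 'C(n0, 2).

Lemma lnrho_ge0 : 0 <= ln rho.
Proof. by rewrite ln_ge0 // ler_pdivlMr ?ltr0n // mul1r ler_nat. Qed.

Lemma last_pair : exists e : pairs 'I_n, val e = block n (n - 2) n.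
Proof.
have c2 : #|block n (n - 2) n| == 2%N by rewrite card_block // subKn //; lia.
by exists (exist (fun e : {set 'I_n} => #|e| == 2%N) (block n (n - 2) n) c2).
Qed.

(** By the pigeonhole principle, some initial segment $T$ of at most $(J-1) n_0$ vertices is
    such that, for a block of $n_0$ further vertices, revealing the other pairs of the block
    raises the energy of none of its pairs by more than the fraction $1/J$ of the maximum. *)
Lemma stable_segment : exists2 j, (j < J)%N &
  forall e : pairs 'I_n, val e \subset block n (j * n0) (j.+1 * n0) ->
  forall B : {set pairs 'I_n}, touching (block n 0 (j * n0)) \subset B ->
    B \subset touching (block n 0 (j * n0)) :|:
      [set e' in inner_pairs (block n (j * n0) (j.+1 * n0)) | e' != e] ->
    energy R X B e - energy R X (touching (block n 0 (j * n0))) e <= J%:R^-1 * N.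
Proof.
have [e0 e0E] := last_pair.
pose psi k := energy R X (touching (block n 0 k)) e0.
have psi_mono k k' : (k <= k')%N -> psi k <= psi k'.
  move=> kk'; apply/energy_mono/touchingS/subsetP => x; rewrite !inE /=.
  by move=> /leq_trans; apply.
have psiE (T : {set 'I_n}) (e : pairs 'I_n) : [disjoint T & val e] -> (#|T| <= n - 2)%N ->
    energy R X (touching T) e = psi #|T|.
  move=> dTe Tn; apply: energy_exchangeable => //.
    by rewrite e0E disjoint_block.
  by rewrite card_block ?subn0 // (leq_trans Tn) ?leq_subr.
have [||j jJ step] := @pigeonhole_increment R (fun j => psi (j * n0)%N) J N J_gt0.
- exact: energy_ge0.
- exact: energy_le.
exists j => // e eS B AB BA; set T := block n 0 (j * n0); set S := block n (j * n0) (j.+1 * n0).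
have jn : (j.+1 * n0 <= n - 2)%N.
  by apply: leq_trans (leq_mul jJ (leqnn n0)) _; rewrite -[leqLHS](addnK 2) leq_sub2r.
have jn' : (j * n0 <= n - 2)%N by apply: leq_trans jn; rewrite leq_mul.
have cT : #|T| = (j * n0)%N by rewrite card_block ?subn0 // (leq_trans jn') ?leq_subr.
have cS : #|S| = n0.
  by rewrite card_block ?(leq_trans jn) ?leq_subr // mulSn addnK.
have dTS : [disjoint T & S] by apply: disjoint_block.
have dTe : [disjoint T & val e] by apply: disjointWr dTS.
rewrite mulrC [energy _ _ (touching T) e]psiE ?cT //.
apply: le_trans step; rewrite lerD2r.
pose T' := T :|: (S :\: val e).
have cT' : (#|T'| <= j.+1 * n0)%N.
  rewrite mulSn addnC -cT -cS; apply: leq_trans (leq_card_setU _ _) _.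
  by rewrite leq_add2l subset_leq_card ?subsetDl.
have BT' : B \subset touching T'.
  apply: subset_trans BA _; rewrite subUset touchingS ?subsetUl //=.
  apply/subsetP => e'; rewrite !inE mem_enum inE => /andP[e'S e'e].
  have /subsetPn[x xe' xe] : ~~ (val e' \subset val e).
    apply: contraNN e'e => sub; apply/eqP/val_inj/eqP.
    by rewrite eqEcard sub !card_pair.
  rewrite -setI_eq0; apply/set0Pn; exists x.
  by have := subsetP e'S _ xe'; rewrite !inE xe' xe => ->; rewrite orbT.
apply: le_trans (energy_mono _ _ _ BT') _.
rewrite psiE; [exact: psi_mono | | exact: leq_trans cT' jn].
rewrite -setI_eq0 setIUl setU_eq0 setI_eq0 dTe /= setI_eq0.
by rewrite disjoints_subset; apply/subsetP => x; rewrite !inE => /andP[].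
Qed.

(** When the likely weights on $S$ form a sparse multigraph, the extremal bound applies. *)
Lemma sum_ln_mode (T S : {set 'I_n}) (w : Om) : #|S| = n0 ->
  let mg : multigraph 'I_n := [ffun e => nat_of_ord (mode X eta (touching T) e w)] in
  (forall Y : {set 'I_n}, Y \subset S -> #|Y| = s -> (weight mg Y <= q)%N) ->
  \sum_(e <- inner_pairs S) ln (mode X eta (touching T) e w).+1%:R <=
    M%:R * lambda + (c + q%:R) * n0.+1%:R * ln rho.
Proof.
move=> cS mg mg_sparse.
have c_ge0 : 0 <= c by rewrite addr_ge0.
have := @sparse_weight_le R _ mg S s q c g s_gt0 _ mg_sparse c_ge0 g_le g_sum S (subxx _).
rewrite cS => /(_ s_le_n0) wS.
have ME : (M%:R : R) = n0%:R * (n0%:R - 1) / 2.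
  by rewrite natr_bin2.
apply: (@le_trans _ _ (\sum_(e <- inner_pairs S)
    (ln a.+1%:R + ((mode X eta (touching T) e w)%:R - a%:R) * ln rho))).
  by apply: ler_sum => e _; apply: ln_chord.
rewrite big_split /= big_const_seq count_predT size_inner_pairs cS iter_addr addr0.
rewrite -mulr_suml sumrB big_const_seq count_predT size_inner_pairs cS iter_addr addr0.
have -> : \sum_(e <- inner_pairs S) (mode X eta (touching T) e w)%:R = (weight mg S)%:R :> R.
  rewrite /weight natr_sum /inner_pairs big_enum /=.
  by apply: eq_big => [e|e _]; rewrite ?inE // ffunE.
rewrite -[ln _ *+ M]mulr_natl -[a%:R *+ M]mulr_natl mulrDr -addrA lerD2l mulrA -mulrDl.
rewrite ler_wpM2r ?lnrho_ge0 //.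
by move: wS c_ge0; rewrite ME /c -[n0.+1%:R]natr1; lra.
Qed.

Lemma sparse_array_gt0 : 0 < N.
Proof.
have s0 : sparse s ([ffun=> ord0] : {ffun pairs 'I_n -> 'I_q.+1}).
  apply/forallP => Y; apply/implyP => _; rewrite /weight big1 // => e _.
  by rewrite !ffunE.
by rewrite ltr0n; apply/card_gt0P; exists (exist (@sparse 'I_n s q) _ s0).
Qed.

(** The encoding bound, with the average number of likely values of a pair estimated on a
    typical set of $n_0$ vertices, where the likely values form a sparse multigraph. *)
Lemma counting_bound :
  ln N <= (J * n0 * n)%:R * ln Q + 'C(n, 2)%:R *
    (lambda + (c + q%:R) * n0.+1%:R * ln rho / M%:R
     + M%:R * (J%:R^-1 / d + Q * d) / eta ^+ M * ln Q
     + (- ln (1 - kap) + Q * eta * ln (Q / kap))).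
Proof.
have [j jJ stable] := stable_segment.
set T := block n 0 (j * n0) in stable; set S := block n (j * n0) (j.+1 * n0) in stable.
have jn : (j.+1 * n0 <= n - 2)%N.
  by apply: leq_trans (leq_mul jJ (leqnn n0)) _; rewrite -[leqLHS](addnK 2) leq_sub2r.
have cT : #|T| = (j * n0)%N.
  rewrite card_block ?subn0 // (@leq_trans (j.+1 * n0)%N) ?leq_mul //.
  by rewrite (leq_trans jn) ?leq_subr.
have cS : #|S| = n0.
  by rewrite card_block ?(leq_trans jn) ?leq_subr // mulSn addnK.
have dTS : [disjoint T & S] by apply: disjoint_block.
set A := touching T in stable.
pose mu e w := mode X eta A e w.
have muA e : measurable_wrt (key X A) (mu e) by apply: mode_measurable.
have N0 := sparse_array_gt0.
have M0 : 0 < (M%:R : R) by rewrite ltr0n bin_gt0.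
have lnQ0 : 0 <= ln Q by rewrite ln_ge0 // ler1n.
pose mg w : multigraph 'I_n := [ffun e => nat_of_ord (mu e w)].
pose P w := ~~ [forall Y : {set 'I_n},
  (Y \subset S) && (#|Y| == s) ==> (weight (mg w) Y <= q)%N].
have P_rare : #|P|%:R * eta ^+ M <= M%:R * ((J%:R^-1 / d + Q * d) * N).
  rewrite -cS -size_inner_pairs.
  apply: (impossible_rare (enum_uniq _) d_gt0 _ muA) => [e|w w' kw||e w|w].
  - rewrite mem_enum inE; exact: stable.
  - suff mgE : mg w = mg w' by rewrite /P mgE.
    by apply/ffunP => e; rewrite !ffunE (muA e _ _ kw).
  - exact: ltW.
  - exact: prob_mode.
  - rewrite /P negb_forall => /existsP[Y]; rewrite negb_imply -ltnNge.
    case/andP=> /andP[YS Ys] wY; apply: contrapT => no.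
    have := forallP (valP w) Y; rewrite Ys leqNgt => /negP; apply.
    apply: leq_trans wY _; apply: eq_leq; apply: eq_bigr => e eY; rewrite !ffunE.
    apply/eqP; apply: contrapT => /negP ne; apply: no; exists e.
      by rewrite mem_enum inE (subset_trans eY).
    by rewrite eq_sym.
have [e1 e1S] : exists e, e \in inner_pairs S.
  have : (0 < size (inner_pairs S))%N by rewrite size_inner_pairs cS bin_gt0.
  by case: (inner_pairs S) => // e ? _; exists e; rewrite mem_head.
have in_dis e : e \in inner_pairs S -> [disjoint T & val e].
  by rewrite mem_enum inE => eS; apply: disjointWr dTS.
pose Lam : R := \sum_w ln (mu e1 w).+1%:R.
have LamE (e : pairs 'I_n) : [disjoint T & val e] -> \sum_w ln (mu e w).+1%:R = Lam.
  move=> dTe.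
  have := @mode_exchangeable R 'I_n s q eta (fun k => ln k.+1%:R) T T e e1 dTe (in_dis _ e1S) (erefl _).
  by rewrite /mu => ->.
have Lam_le : M%:R * Lam <= N * (M%:R * lambda + (c + q%:R) * n0.+1%:R * ln rho)
                            + #|P|%:R * (M%:R * ln Q).
  have -> : M%:R * Lam = \sum_w \sum_(e <- inner_pairs S) ln (mu e w).+1%:R.
    rewrite exchange_big /= big_seq (eq_bigr (fun=> Lam)) => [|e eS]; last first.
      by rewrite LamE ?in_dis.
    by rewrite -big_seq big_const_seq count_predT size_inner_pairs cS iter_addr addr0 mulr_natl.
  rewrite [N * _]mulr_natl -sumr_const [_ * (M%:R * ln Q)]mulr_natl -sumr_const.
  rewrite [X in _ + X]big_mkcond -big_split /=; apply: ler_sum => w _.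
  case: ifPn => [_|]; last first.
    rewrite addr0 unfold_in negbK => /forallP mgP; apply: sum_ln_mode => // Y YS Ys.
    by have := mgP Y; rewrite YS Ys eqxx.
  rewrite ler_wpDl //.
    rewrite addr_ge0 ?mulr_ge0 ?lnrho_ge0 ?addr_ge0 ?mulr_ge0 ?lnrho_ge0 //.
    by rewrite ln_ge0 ?ler1n.
  rewrite mulr_natl -cS -size_inner_pairs -(count_predT (inner_pairs S)) -[_ *+ _]addr0.
  rewrite -iter_addr -big_const_seq; apply: ler_sum => e _.
  by rewrite ler_ln ?posrE ?ltr0n // ler_nat ltn_ord.
have enc := encoding (val_inj : injective X) kap01 muA.
have kap_ge0 : 0 <= - ln (1 - kap).
  by case/andP: kap01 => k0 k1; rewrite oppr_ge0 ln_le0 // gerBl ltW.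
have Qk_ge0 : 0 <= ln (Q / kap).
  case/andP: kap01 => k0 k1; rewrite ln_ge0 // ler_pdivlMr // mul1r.
  by apply: le_trans (ltW k1) _; rewrite ler1n.
pose term : R := Lam + N * (- ln (1 - kap) + Q * eta * ln (Q / kap)).
have Lam_ge0 : 0 <= Lam by apply: sumr_ge0 => w _; rewrite ln_ge0 ?ler1n.
have term_ge0 : 0 <= term.
  by rewrite addr_ge0 // mulr_ge0 ?(ltW N0) // addr_ge0 // mulr_ge0 // mulr_ge0 // ltW.
have code_sum_le : \sum_w \sum_(e | e \notin A) - ln (code kap (mu e w) (X w e))
    <= 'C(n, 2)%:R * term.
  apply: (@le_trans _ _ (\sum_(e | e \notin A) term)).
    rewrite exchange_big /=; apply: ler_sum => e eA.
    have dTe : [disjoint T & val e] by move: eA; rewrite inE negbK disjoint_sym.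
    apply: le_trans (ler_sum _ (fun w _ => ln_code _ _ kap01)) _.
    rewrite big_split sumrB /= LamE // sumr_const -[_ *+ _]mulr_natl -mulr_suml.
    rewrite /term mulrDr addrA mulrN lerD2l mulrA ler_wpM2r // mulrC.
    by rewrite [leRHS]mulrC [leRHS]mulrC; apply: overflow; apply: ltW.
  rewrite sumr_const -[_ *+ _]mulr_natl ler_wpM2r // ler_nat.
  by apply: leq_trans (max_card _) _; rewrite card_pairs card_ord.
have A_le : #|A|%:R * ln Q <= (J * n0 * n)%:R * ln Q.
  rewrite ler_wpM2r // ler_nat; apply: leq_trans (card_touching _) _.
  by rewrite card_ord cT leq_mul // leq_mul // ltnW.
have etaM : 0 < eta ^+ M by rewrite exprn_gt0.
have {}Lam_le : Lam <= N * (lambda + (c + q%:R) * n0.+1%:R * ln rho / M%:R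
     + M%:R * (J%:R^-1 / d + Q * d) / eta ^+ M * ln Q).
  have PN : #|P|%:R <= M%:R * (J%:R^-1 / d + Q * d) / eta ^+ M * N.
    by rewrite mulrAC ler_pdivlMr // -mulrA.
  rewrite -(ler_pM2l M0); apply: le_trans Lam_le _.
  apply: le_trans (lerD (lexx _) (ler_wpM2r (mulr_ge0 (ltW M0) lnQ0) PN)) _.
  move: (_ / eta ^+ M) (ln Q) ((_ + _) * _ * _) lambda => y z u v.
  rewrite le_eqVlt; apply/orP; left; apply/eqP.
  have uE : u = M%:R * (u / M%:R) by rewrite mulrC divfK // gt_eqF.
  rewrite {1}uE; move: (u / _) => t; ring.
rewrite -(ler_pM2l N0); apply: le_trans enc _.
rewrite [leRHS]mulrDr; apply: lerD; first by rewrite ler_wpM2l // ltW.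
apply: le_trans code_sum_le _; rewrite mulrCA ler_wpM2l //.
by rewrite /term [leRHS]mulrDr lerD2r.
Qed.

End CountingBound.

(** * Asymptotic upper bound *)

Section LogCountUpper.
Variables (R : realType) (s q a : nat) (theta : R) (g : nat -> nat).
Let c : R := a%:R + theta.
Hypothesis s_gt0 : (0 < s)%N.
Hypothesis theta_ge0 : 0 <= theta.
Hypothesis g_le : forall k, (0 < k < s)%N -> (g k)%:R <= c * k%:R + 1.
Hypothesis g_sum : (q < \sum_(1 <= k < s) g k)%N.
Local Notation rho := (a.+2%:R / a.+1%:R : R).
Local Notation lambda := (ln a.+1%:R + theta * ln rho).
Local Notation Q := (q.+1%:R : R).

Lemma exists_nat_gt (x : R) : exists k : nat, x < k%:R.
Proof. by eexists; apply: truncnS_gt. Qed.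

(** All error terms of [counting_bound] are made small by choosing in turn the share [kap] of
    exceptional weights, the threshold [eta], the sample size [n0], the scale [d] and the
    number [J] of pigeonhole steps. *)
Lemma log_count_upper (eps : R) : 0 < eps -> exists n1 : nat, forall n, (n1 <= n)%N ->
  ln (#|{: sparse_array 'I_n s q}|%:R : R) <= 'C(n, 2)%:R * lambda + eps * n%:R ^+ 2.
Proof.
move=> eps0; pose e := eps / 3; have e0 : 0 < e by rewrite divr_gt0.
have Q0 : 0 < Q by rewrite ltr0n.
have Q1 : 1 <= Q by rewrite ler1n.
have lnQ0 : 0 <= ln Q by rewrite ln_ge0.
have lnrho0 : 0 <= ln rho by apply: lnrho_ge0.
have c0 : 0 <= c by rewrite addr_ge0.
pose kap : R := 1 - expR (- e).
have kap01 : 0 < kap < 1.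
  by rewrite subr_gt0 expR_lt1 oppr_lt0 e0 gtrBl expR_gt0.
have ln_kap : - ln (1 - kap) = e by rewrite subKr expRK opprK.
pose L := ln (Q / kap).
have L0 : 0 <= L.
  case/andP: kap01 => k0 k1; rewrite ln_ge0 // ler_pdivlMr // mul1r.
  exact: le_trans (ltW k1) Q1.
pose z := 1 + (L + 1) / e.
have z1 : 1 <= z by rewrite lerDl divr_ge0 ?(ltW e0) // addr_ge0.
have z0 : 0 < z by apply: lt_le_trans z1.
pose eta := (Q * z)^-1.
have eta0 : 0 < eta by rewrite invr_gt0 mulr_gt0.
have etaQ : eta * Q = z^-1 by rewrite /eta invfM mulrC mulVKf ?gt_eqF.
have eta_le : eta * Q <= 1 by rewrite etaQ invf_le1.
have eta_L : Q * eta * L <= e.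
  rewrite [Q * eta]mulrC etaQ mulrC ler_pdivrMr // /z mulrDr mulr1 mulrC divfK ?gt_eqF //.
  lra.
pose C := (c + q%:R) * ln rho.
have C0 : 0 <= C by rewrite mulr_ge0 ?addr_ge0.
have [k kC] := exists_nat_gt (6 * C / e).
pose n0 := (s + 2 + k)%N.
have n0_2 : (1 < n0)%N by rewrite /n0 addnAC leq_addl.
have M_gt0 : 0 < ('C(n0, 2)%:R : R) by rewrite ltr0n bin_gt0.
have n0_bound : (c + q%:R) * n0.+1%:R * ln rho / 'C(n0, 2)%:R <= e.
  rewrite ler_pdivrMr // mulrAC -/C natr_bin2.
  have n0k : k%:R <= (n0%:R : R) by rewrite ler_nat leq_addl.
  have n02 : 2 <= (n0%:R : R) by rewrite ler_nat.
  have : 6 * C <= e * n0%:R.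
    by rewrite [e * _]mulrC -ler_pdivrMr //; apply: le_trans (ltW kC) n0k.
  rewrite -[n0.+1%:R]natr1; nra.
set M : R := 'C(n0, 2)%:R in M_gt0 n0_bound.
pose W := M * (1 + Q) * (ln Q + 1) / eta ^+ 'C(n0, 2).
have W0 : 0 < W.
  have Q10 : 0 < 1 + Q by rewrite addr_gt0.
  have L10 : 0 < ln Q + 1 by rewrite ltr_wpDl.
  by rewrite divr_gt0 ?exprn_gt0 // mulr_gt0 // mulr_gt0.
pose d := e / W.
have d0 : 0 < d by rewrite divr_gt0.
have [J' J'd] := exists_nat_gt (d ^- 2); pose J := J'.+1.
have J0 : 0 < (J%:R : R) by rewrite ltr0n.
have Jd : J%:R^-1 / d <= d.
  rewrite ler_pdivrMr // -expr2 -[leRHS]invrK lef_pV2 ?posrE ?invr_gt0 ?exprn_gt0 //.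
  by apply: le_trans (ltW J'd) _; rewrite ler_nat.
have d_bound : M * (J%:R^-1 / d + Q * d) / eta ^+ 'C(n0, 2) * ln Q <= e.
  apply: (@le_trans _ _ (d * W)); last by rewrite /d divfK ?gt_eqF.
  rewrite /W; set u := (eta ^+ _)^-1.
  have u0 : 0 < u by rewrite invr_gt0 exprn_gt0.
  apply: (@le_trans _ _ (M * ((1 + Q) * d) * u * (ln Q + 1))).
    apply: ler_pM; rewrite ?lerDl //.
      have x0 : 0 <= J%:R^-1 / d + Q * d.
        apply: addr_ge0; last by rewrite mulr_ge0 // ltW.
        by rewrite divr_ge0 // ?invr_ge0 ltW.
      by rewrite mulr_ge0 ?(ltW u0) // mulr_ge0 // ltW.
    rewrite ler_pM2r // ler_pM2l // mulrDl mul1r lerD2r //.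
  by rewrite le_eqVlt; apply/orP; left; apply/eqP; ring.
have [n2 n2_bound] := exists_nat_gt ((J * n0)%:R * ln Q / e).
exists (J * n0 + 2 + n2)%N => n n_large.
have nJ : (J * n0 + 2 <= n)%N by apply: leq_trans n_large; apply: leq_addr.
have s_n0 : (s <= n0)%N by rewrite /n0 -addnA leq_addr.
have := @counting_bound R n s q a theta g s_gt0 theta_ge0 g_le g_sum n0 J kap eta d
  s_n0 n0_2 isT nJ kap01 eta0 eta_le d0.
move=> /le_trans; apply.
have JnQ : (J * n0 * n)%:R * ln Q <= e * n%:R ^+ 2.
  rewrite natrM mulrAC expr2 mulrA ler_wpM2r //.
  rewrite [e * _]mulrC -ler_pdivrMr //; apply: le_trans (ltW n2_bound) _.
  by rewrite ler_nat; apply: leq_trans n_large; apply: leq_addl.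
have Cn : 0 <= ('C(n, 2)%:R : R) <= n%:R ^+ 2 / 2.
  by rewrite ler0n natr_bin2 expr2 ler_pM2r ?invr_gt0 // ler_wpM2l // gerBl.
rewrite -/M -/c -/L ln_kap.
have -> : eps = 3 * e by rewrite /e mulrC divfK.
move: n0_bound d_bound eta_L JnQ Cn.
move: (_ / M) (_ * ln Q) (Q * eta * L) (_ * ln Q) 'C(n, 2)%:R (n%:R ^+ 2) lambda
  => x1 x2 x3 x4 x5 x6 x7 h1 h2 h3 h4 /andP[h5 h6].
have : x5 * (x1 + x4 + x3) <= x5 * (3 * e) by rewrite ler_wpM2l //; lra.
have : x5 * e <= x6 / 2 * e by rewrite ler_wpM2r // ltW.
lra.
Qed.

End LogCountUpper.

(** * Counting multigraphs below a given one *)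

Lemma cardF_sparse_array n s q : (1 < s)%N -> (s <= n)%N ->
  cardF n s q = #|{: sparse_array 'I_n s q}|.
Proof.
move=> s1 sn; rewrite /cardF.
pose f (w : sparse_array 'I_n s q) : multigraph 'I_n := bounded_multigraph (val w).
have f_inj : injective f.
  move=> w w' /ffunP ww; apply/val_inj/ffunP => e; apply: val_inj.
  by have := ww e; rewrite !ffunE.
have finF : finite_set (@F n s q) /\ forall w, F s q w <-> exists x, f x = w.
  suff FE w : F s q w <-> exists x, f x = w.
    split=> //; apply: (@sub_finite_set _ _ (f @` classical_sets.setT)%classic).
      by move=> w /FE[x <-]; exists x.
    exact/finite_image/finite_finset.
  split=> [Fw|[x <-] X Xs]; last by have := forallP (valP x) X; rewrite Xs eqxx.
  have w_le e : (w e < q.+1)%N.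
    have [|X [eX _ Xs]] := @superset_card _ (val e) setT s (subsetT _).
      by rewrite card_pair s1 cardsT card_ord.
    rewrite ltnS; apply: leq_trans (Fw X Xs).
    by rewrite /weight (bigD1 e) //= leq_addr.
  pose x : {ffun pairs 'I_n -> 'I_q.+1} := [ffun e => Ordinal (w_le e)].
  have bx : bounded_multigraph x = w by apply/ffunP => e; rewrite !ffunE.
  have xs : sparse s x.
    by apply/forallP => X; apply/implyP => /eqP; rewrite bx; exact: Fw.
  by exists (exist _ x xs).
case: finF => fin FE.
have -> : fset_set (@F n s q) = [fset f x | x in {: sparse_array 'I_n s q}]%fset.
  apply/fsetP => w; rewrite in_fset_set //; apply/idP/imfsetP => [|[x _ ->]].
    by rewrite in_setE => /FE[x <-]; exists x.
  by rewrite in_setE; apply/FE; exists x.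
by rewrite card_imfset //= cardE.
Qed.

(** All multigraphs below a sparse one are sparse. *)
Lemma prod_le_sparse (V : finType) s q (cap : pairs V -> nat) :
  (1 < s)%N -> (s <= #|V|)%N ->
  (forall X : {set V}, #|X| = s -> (\sum_(e : pairs V | val e \subset X) cap e <= q)%N) ->
  (\prod_e (cap e).+1 <= #|{: sparse_array V s q}|)%N.
Proof.
move=> s1 sV capX.
have cap_le e : (cap e <= q)%N.
  have [|X [eX _ Xs]] := @superset_card _ (val e) setT s (subsetT _).
    by rewrite card_pair s1 cardsT.
  by apply: leq_trans (capX X Xs); rewrite (bigD1 e) //= leq_addr.
have -> : (\prod_e (cap e).+1 = #|family (fun e => [pred c : 'I_q.+1 | c < (cap e).+1])|)%N.
  transitivity (\prod_e \sum_(c : 'I_q.+1 | (c < (cap e).+1)%N) 1)%N; last first.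
    rewrite bigA_distr_big_dep -sum1_card; apply: eq_bigr => x _.
    by rewrite big1_eq.
  apply: eq_bigr => e _.
  rewrite -(big_ord_widen q.+1 (fun=> 1%N)); last by rewrite ltnS.
  by rewrite sum1_card card_ord.
rewrite card_sig; apply: subset_leq_card; apply/subsetP => x /familyP xP.
rewrite inE; apply/forallP => X; apply/implyP => /eqP /capX; apply: leq_trans.
by apply: leq_sum => e _; rewrite ffunE; have := xP e; rewrite inE.
Qed.

Lemma prod_two_values (I : finType) (G : {set I}) (a b : nat) :
  (\prod_i (if i \in G then a else b) = a ^ #|G| * b ^ (#|I| - #|G|))%N.
Proof.
rewrite (bigID [in G]) /=; congr (_ * _)%N.
  by rewrite (eq_bigr (fun=> a)) ?prod_nat_const // => i ->.
rewrite (eq_bigr (fun=> b)) => [|i /negPf-> //].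
by rewrite prod_nat_const -(cardsC G) addKn; congr (_ ^ _)%N; apply: eq_card => i; rewrite !inE.
Qed.

(** The handshake lemma. *)
Lemma pair_weight_sum (V : finType) (w : multigraph V) (Y : {set V}) :
  (\sum_(x in Y) \sum_(y in Y) pair_weight w x y = 2 * weight w Y)%N.
Proof.
move: {2}#|Y| (erefl #|Y|) => m; elim: m Y => [|m IH] Y Ym.
  have -> : Y = set0 by apply: cards0_eq.
  rewrite big_set0 /weight big1 ?muln0 // => e; rewrite subset0 => /eqP e0.
  by have := card_pair e; rewrite e0 cards0.
have /card_gt0P[x xY] : (0 < #|Y|)%N by rewrite Ym.
have Ym' : #|Y :\ x| = m by have := cardsD1 x Y; rewrite xY Ym => -[].
rewrite -(setD1K xY) weightU1 ?setD11 // !big_setU1 ?setD11 //=.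
rewrite pair_weightxx add0n.
under [X in (_ + X)%N]eq_bigr do rewrite big_setU1 ?setD11 //= pair_weightC.
rewrite big_split /= IH //; lia.
Qed.

Section Multipartite.
Variables (V : finType) (r : nat) (part : V -> 'I_r).
Implicit Types X : {set V}.

(** The pairs outside the complete multipartite graph are those inside a part. *)
Lemma notin_multipartite (e : pairs V) x y : val e = [set x; y] ->
  (e \notin multipartite_edges part) = (part x == part y).
Proof.
move=> ee; rewrite inE; apply/negP/eqP => [no|pxy].
  apply/eqP; apply: contrapT => /negP pxy; apply: no.
  by apply/existsP; exists x; rewrite ee set21; apply/existsP; exists y; rewrite set22.
move=> /existsP[z /andP[+ /existsP[t /andP[]]]].
by rewrite ee !inE => /orP[] /eqP-> /orP[] /eqP->; rewrite ?pxy eqxx.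
Qed.

(** A set of more than $r$ vertices contains two vertices of the same part; removing them
    one at a time exhibits at least $|X| - r$ pairs inside the parts. *)
Lemma inner_pairs_multipartite X :
  (#|X| - r <= #|[set e : pairs V | (val e \subset X) && (e \notin multipartite_edges part)]|)%N.
Proof.
move: {2}#|X| (erefl #|X|) => m; elim: m X => [|m IH] X Xm; first by rewrite Xm.
have [Xr|rX] := leqP #|X| r; first by rewrite (eqP (Xr : (_ - _ == 0)%N)).
have /dinjectivePn[x xX [y xy pxy]] : ~~ dinjectiveb part X.
  apply: contraL rX => /dinjectiveP inj; rewrite -leqNgt -(card_in_imset inj).
  by rewrite -[leqRHS]card_ord max_card.
have [yx yX] : y != x /\ y \in X by move: xy; rewrite !inE => /andP.
have Ym : #|X :\ x| = m by have := cardsD1 x X; rewrite xX Xm => -[].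
have xy2 : #|[set x; y]| == 2%N by rewrite cards2 [x == y]eq_sym yx.
pose e0 : pairs V := exist (fun e : {set V} => #|e| == 2%N) [set x; y] xy2.
apply: (@leq_trans #|e0 |: [set e : pairs V | (val e \subset X :\ x)
    && (e \notin multipartite_edges part)]|).
  rewrite cardsU1 inE subsetD1 set21 andbF /= add1n Xm.
  apply: (@leq_trans (m - r).+1); last by have := IH _ Ym; rewrite Ym.
  by rewrite subSn // -ltnS -Xm.
apply: subset_leq_card; apply/subsetP => e; rewrite !inE => /orP[/eqP->|/andP[eX ne]].
  rewrite subUset !sub1set xX yX /=.
  have := @notin_multipartite e0 x y (erefl _); rewrite inE => ->; exact/eqP.
by rewrite ne andbT (subset_trans eX) ?subsetDl.
Qed.

(** A balanced partition has at most $n^2/2r$ pairs inside its parts. *)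
Lemma balanced_inner_pairs : balanced part ->
  (2 * r * #|~: multipartite_edges part| <= #|V| ^ 2)%N.
Proof.
move=> bal; pose size_part i := #|[set x | part x == i]|.
have size_le i : (r * (size_part i).-1 <= #|V|)%N.
  have sumV : (\sum_(j < r) size_part j = #|V|)%N.
    rewrite -sum1_card (partition_big part predT) //=; apply: eq_bigr => j _.
    by rewrite /size_part -sum1_card; apply: eq_bigl => x; rewrite inE.
  rewrite -sumV -[r in leqLHS]card_ord -sum_nat_const leq_sum // => j _.
  have := bal i j; rewrite -/(size_part i) -/(size_part j); lia.
pose w : multigraph V := [ffun e => (e \notin multipartite_edges part) : nat].
have -> : #|~: multipartite_edges part| = weight w setT.
  rewrite -sum1_card /weight big_mkcond [RHS]big_mkcond; apply: eq_bigr => e _.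
  by rewrite ffunE subsetT in_setC; case: (e \in _).
have pw x y : (pair_weight w x y <= (x != y) && (part x == part y))%N.
  have [->|xy] := eqVneq x y; first by rewrite pair_weightxx.
  have xy2 : #|[set x; y]| == 2%N by rewrite cards2 xy.
  pose e0 : pairs V := exist (fun e : {set V} => #|e| == 2%N) [set x; y] xy2.
  rewrite /pair_weight (big_pred1 e0) => [|e]; last by rewrite -[RHS]val_eqE.
  by rewrite ffunE (@notin_multipartite e0 x y).
rewrite mulnAC -pair_weight_sum mulnC big_distrr /=.
apply: (@leq_trans (\sum_(x in [set: V]) #|V|)%N); last first.
  by rewrite sum_nat_const cardsT.
apply: leq_sum => x _; apply: leq_trans (size_le (part x)); rewrite leq_mul2l.
apply/orP; right; rewrite /size_part (cardsD1 x) inE eqxx add1n /=.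
rewrite -sum1_card [leqRHS]big_mkcond [leqLHS]big_mkcond leq_sum // => y _.
rewrite !inE; apply: leq_trans (pw x y) _.
by rewrite eq_sym [part x == _]eq_sym; case: (_ && _).
Qed.

End Multipartite.

Lemma turan_number_ge n r : (0 < r)%N ->
  (2 * r * 'C(n, 2) <= 2 * r * turan_number r n + n ^ 2)%N.
Proof.
case: r => // r _; have := balanced_inner_pairs (@turan_part_balanced r n).
rewrite card_ord -/(turan_graph r.+1 n) /turan_number => H.
have -> : 'C(n, 2) = (#|turan_graph r.+1 n| + #|~: turan_graph r.+1 n|)%N.
  by rewrite cardsC card_pairs card_ord.
by rewrite mulnDr leq_add2l.
Qed.

(** * The two dense regimes *)

Section Asymptotics.
Variable R : realType.
Local Open Scope classical_set_scope.

(** An estimate of [ln (N n)] up to $o(n^2)$, written with an exponent of base $b$. *)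
Lemma asymptotic_form (b : R) (a : nat) (N : nat -> nat) (T : nat -> R) :
  1 < b -> (\forall n \near \oo, (0 < N n)%N) ->
  (forall eps : R, 0 < eps -> \forall n \near \oo,
     `|ln ((N n)%:R : R) - 'C(n, 2)%:R * ln a.+1%:R - T n * ln b| <= eps * n%:R ^+ 2) ->
  exists2 f : nat -> R, f =o_\oo (fun n : nat => n%:R ^+ 2 : R) &
    \forall n \near \oo, (N n)%:R = (a + 1)%:R ^+ 'C(n, 2) * b `^ (T n + f n).
Proof.
move=> b1 N0 bound; have lnb : 0 < ln b by rewrite ln_gt0.
have b0 : 0 < b by apply: lt_trans b1.
pose f n := (ln ((N n)%:R : R) - 'C(n, 2)%:R * ln a.+1%:R - T n * ln b) / ln b.
exists f.
  apply/eqoP => eps eps0; have := bound (eps * ln b) (mulr_gt0 eps0 lnb).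
  apply: filterS => n Hn; rewrite /f normrM [X in _ * X]gtr0_norm ?invr_gt0 //.
  by rewrite ler_pdivrMr // mulrAC (ger0_norm (sqr_ge0 _)).
apply: filterS N0 => n Nn; rewrite addn1 /powR gt_eqF //.
have -> : (T n + f n) * ln b = ln (N n)%:R - 'C(n, 2)%:R * ln a.+1%:R.
  by rewrite mulrDl /f divfK ?gt_eqF // addrC subrK.
rewrite expRB lnK ?posrE ?ltr0n // ['C(n, 2)%:R * _]mulr_natl -lnXn ?ltr0n // lnK ?posrE ?exprn_gt0 ?ltr0n //.
by rewrite mulrC divfK // expf_eq0 pnatr_eq0 andbF.
Qed.

Section Regime.
Variables (s q a : nat) (theta : R) (g : nat -> nat) (K : R) (E : nat -> nat).
Local Notation rho := (a.+2%:R / a.+1%:R : R).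
Hypothesis s_gt1 : (1 < s)%N.
Hypothesis theta_ge0 : 0 <= theta.
Hypothesis g_le : forall k, (0 < k < s)%N -> (g k)%:R <= (a%:R + theta) * k%:R + 1 :> R.
Hypothesis g_sum : (q < \sum_(1 <= k < s) g k)%N.
Hypothesis E_lower : forall n, (s <= n)%N ->
  ((a.+1 ^ 'C(n, 2))%:R * rho ^+ E n <= (cardF n s q)%:R :> R).
Hypothesis E_density : forall n, theta * 'C(n, 2)%:R <= (E n)%:R + K * n%:R.

Lemma cardF_gt0 n : (s <= n)%N -> (0 < cardF n s q)%N.
Proof.
move=> sn; rewrite -(ltr_nat R); apply: lt_le_trans (E_lower sn).
by rewrite mulr_gt0 ?exprn_gt0 ?divr_gt0 ?ltr0n // expn_gt0.
Qed.

(** The lower bound given by a construction with $E(n)$ heavy pairs meets the upper bound as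
    soon as $E(n)$ is asymptotically the fraction [theta] of all pairs. *)
Lemma regime_asymptotics (eps : R) : 0 < eps -> \forall n \near \oo,
  `|ln ((cardF n s q)%:R : R) - 'C(n, 2)%:R * ln a.+1%:R - (E n)%:R * ln rho|
    <= eps * n%:R ^+ 2.
Proof.
move=> eps0; have e0 : 0 < eps / 2 by rewrite divr_gt0.
have [n1 upper] := log_count_upper (ltnW s_gt1) theta_ge0 g_le g_sum e0.
have rho0 : 0 < rho by rewrite divr_gt0 ?ltr0n.
have lnrho : 0 <= ln rho := lnrho_ge0 R a.
have [n2 n2_gt] := exists_nat_gt (K * ln rho / (eps / 2)).
exists (s + n1 + n2)%N => // n /= n_large.
have sn : (s <= n)%N by apply: leq_trans n_large; rewrite -addnA leq_addr.
have n1n : (n1 <= n)%N by apply: leq_trans n_large; rewrite addnAC leq_addl.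
have n2n : (n2 <= n)%N by apply: leq_trans n_large; rewrite leq_addl.
have lower : 'C(n, 2)%:R * ln a.+1%:R + (E n)%:R * ln rho <= ln (cardF n s q)%:R.
  have low0 : 0 < (a.+1 ^ 'C(n, 2))%:R * rho ^+ E n.
    by rewrite mulr_gt0 ?exprn_gt0 ?ltr0n // expn_gt0.
  have card0 : 0 < (cardF n s q)%:R :> R by rewrite ltr0n cardF_gt0.
  have := E_lower sn; rewrite -(ler_ln low0 card0).
  rewrite lnM ?posrE ?exprn_gt0 ?ltr0n ?expn_gt0 // natrX !lnXn ?ltr0n //.
  by rewrite -![ln _ *+ _]mulr_natl.
have {}upper := upper n n1n; rewrite -cardF_sparse_array // in upper.
have Kn : K * n%:R * ln rho <= eps / 2 * n%:R ^+ 2.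
  rewrite mulrAC expr2 mulrA ler_wpM2r //.
  rewrite [leRHS]mulrC -ler_pdivrMr //; apply: le_trans (ltW n2_gt) _.
  by rewrite ler_nat.
have dens := ler_wpM2r lnrho (E_density n).
by rewrite ger0_norm; lra.
Qed.

End Regime.

Lemma sum_nat_linear (a m : nat) : (\sum_(1 <= k < m) a * k = a * 'C(m, 2))%N.
Proof.
rewrite -big_distrr /= -bin2_sum; case: m => [|m]; first by rewrite !big_geq.
by rewrite [in RHS]big_ltn.
Qed.

(** Here [theta = 0] and $g(k) = ak + 1$, the least integer larger than $ak$; the lower bound
    comes from the multigraphs with all weights at most $a$. *)
Lemma part_small_excess (s q a b : nat) : (2 <= s)%N -> q = (a * 'C(s, 2) + b)%N ->
  (b <= s - 2)%N ->
  exists2 f : nat -> R, f =o_\oo (fun n : nat => n%:R ^+ 2 : R) &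
    \forall n \near \oo, (cardF n s q)%:R = (a + 1)%:R ^+ 'C(n, 2) * 2 `^ f n.
Proof.
move=> s2 qE bs.
have g_le k : (0 < k < s)%N -> (a * k + 1)%:R <= (a%:R + 0) * k%:R + 1 :> R.
  by move=> _; rewrite natrD natrM addr0.
have g_sum : (q < \sum_(1 <= k < s) (a * k + 1))%N.
  rewrite big_split /= sum_nat_linear sum_nat_const_nat muln1 qE ltn_add2l.
  by move: bs s2; clear; lia.
have E_lower n : (s <= n)%N ->
    (a.+1 ^ 'C(n, 2))%:R * (a.+2%:R / a.+1%:R) ^+ 0 <= (cardF n s q)%:R :> R.
  move=> sn; rewrite mulr1 ler_nat cardF_sparse_array //.
  have := @prod_le_sparse 'I_n s q (fun=> a) s2.
  rewrite card_ord prod_nat_const card_pairs card_ord; apply=> // X Xs.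
  rewrite sum_nat_const (_ : #|_| = 'C(s, 2)); first by rewrite qE mulnC leq_addr.
  by rewrite -Xs -size_inner_pairs cardE.
have E_density n : 0 * 'C(n, 2)%:R <= 0%:R + 0 * n%:R :> R.
  by rewrite !mul0r addr0.
have asym := @regime_asymptotics s q a 0 _ 0 (fun=> 0%N) s2 (lexx _) g_le g_sum E_lower E_density.
have [||f fo fE] := @asymptotic_form 2 a (fun n => cardF n s q) (fun=> 0) (ltr1n _ 2).
- exists s => // n /= sn; exact: (cardF_gt0 E_lower sn).
- move=> eps /asym; apply: filterS => n; by rewrite !mul0r.
exists f => //; apply: filterS fE => n ->; by rewrite add0r.
Qed.

(** Here $r = s - t$ and [theta] is $1 - 1/r$. The least integer larger than
    $(a + 1)k - k/r$ is $(a + 1)k$ for $k \le r$ and $(a + 1)k - 1$ for $r < k \le 2r$. The lower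
    bound comes from weights at most $a + 1$ on the Turan graph and at most $a$ elsewhere:
    any $s$ vertices miss at least $s - r = t$ pairs of the Turan graph. *)
Lemma part_turan (s q a b t : nat) : (2 <= s)%N -> q = (a * 'C(s, 2) + b)%N ->
  (2 <= t)%N -> (t%:R <= s%:R / 2 :> R) -> b = ('C(s, 2) - t)%N ->
  exists2 f : nat -> R, f =o_\oo (fun n : nat => n%:R ^+ 2 : R) &
    \forall n \near \oo, (cardF n s q)%:R = (a + 1)%:R ^+ 'C(n, 2) *
      ((a + 2)%:R / (a + 1)%:R) `^ ((turan_number (s - t) n)%:R + f n).
Proof.
move=> s2 qE t2 ts bE; pose r := (s - t)%N.
have t2s : (2 * t <= s)%N.
  by move: ts; rewrite ler_pdivlMr // -natrM ler_nat mulnC.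
have r0 : (0 < r)%N by rewrite /r; move: t2s t2; clear; lia.
have tr : (t <= r)%N by rewrite /r; move: t2s; clear; lia.
have rts : (r + t = s)%N by rewrite /r subnK //; move: t2s; clear; lia.
have tC : (t <= 'C(s, 2))%N.
  have : (s * s.-1 = 2 * 'C(s, 2))%N by rewrite -mul_bin_diag bin1.
  move: s2 t2s; case: (s) => // s' /= s2' ts'; nia.
pose g k := ((a + 1) * k - (r < k))%N.
pose theta : R := 1 - r%:R^-1.
have rR : 0 < r%:R :> R by rewrite ltr0n.
have theta0 : 0 <= theta by rewrite subr_ge0 invf_le1 // ler1n.
have g_le k : (0 < k < s)%N -> (g k)%:R <= (a%:R + theta) * k%:R + 1 :> R.
  case/andP=> k0 ks.
  have -> : (g k)%:R = (a%:R + 1) * k%:R - ((r < k)%N)%:R :> R.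
    rewrite /g natrB ?natrM ?natrD //.
    by case: (r < k)%N => //; rewrite muln_gt0 k0 addn1.
  suff : k%:R / r%:R <= 1 + ((r < k)%N)%:R :> R by rewrite /theta; lra.
  rewrite ler_pdivrMr // -(natrD _ 1) -natrM ler_nat.
  by move: rts tr ks; case: ltnP; clear; lia.
have g_sum : (q < \sum_(1 <= k < s) g k)%N.
  have gE : (\sum_(1 <= k < s) g k + \sum_(1 <= k < s) (r < k) = (a + 1) * 'C(s, 2))%N.
    rewrite -big_split -sum_nat_linear /=; apply: eq_big_nat => k /andP[k0 _].
    by rewrite /g subnK //; case: (r < k)%N => //; rewrite muln_gt0 k0 addn1.
  have cE : (\sum_(1 <= k < s) (r < k) = s - r.+1)%N.
    rewrite -[RHS]muln1 -sum_nat_const_nat (big_nat_widenl r.+1 1) //= [RHS]big_mkcond /=.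
    by apply: eq_bigr => k _; case: (r < k)%N.
  move: gE tC t2; rewrite cE qE bE -rts mulnDl mul1n; clear; lia.
have E_lower n : (s <= n)%N -> (a.+1 ^ 'C(n, 2))%:R *
    (a.+2%:R / a.+1%:R) ^+ turan_number r n <= (cardF n s q)%:R :> R.
  move=> sn; rewrite cardF_sparse_array // /turan_number; set G := turan_graph r n.
  pose cap (e : pairs 'I_n) := (a + (e \in G))%N.
  have Gle : (#|G| <= 'C(n, 2))%N.
    by apply: leq_trans (max_card _) _; rewrite card_pairs card_ord.
  have -> : (a.+1 ^ 'C(n, 2))%:R * (a.+2%:R / a.+1%:R) ^+ #|G| =
      (\prod_e (cap e).+1)%:R :> R.
    rewrite (eq_bigr (fun e => if e \in G then a.+2 else a.+1)); last first.
      by move=> e _; rewrite /cap; case: (e \in G); rewrite ?addn1 ?addn0.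
    rewrite prod_two_values card_pairs card_ord -{1}(subnK Gle) expnD !natrM !natrX expr_div_n.
    rewrite [RHS]mulrC -mulrA; congr (_ * _).
    by rewrite mulrC divfK // expf_eq0 pnatr_eq0 andbF.
  rewrite ler_nat; apply: prod_le_sparse; rewrite ?card_ord // => X Xs.
  have innerE (P : pred (pairs 'I_n)) :
      (\sum_(e : pairs 'I_n | val e \subset X) P e =
       #|[set e : pairs 'I_n | (val e \subset X) && P e]%SET|)%N.
    rewrite -sum1_card; under [RHS]eq_bigl do rewrite inE.
    by rewrite big_mkcondr; apply: eq_bigr => e _; case: (P e).
  have sum_const (k : nat) :
      (\sum_(e : pairs 'I_n | val e \subset X) k = 'C(s, 2) * k)%N.
    by rewrite sum_nat_const -Xs -size_inner_pairs cardE.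
  have inG : (\sum_(e : pairs 'I_n | val e \subset X) (e \in G) +
      \sum_(e : pairs 'I_n | val e \subset X) (e \notin G) = 'C(s, 2))%N.
    rewrite -big_split /= -[RHS]muln1 -sum_const; apply: eq_bigr => e _.
    by case: (e \in G).
  have outG : (t <= \sum_(e : pairs 'I_n | val e \subset X) (e \notin G))%N.
    rewrite (innerE (fun e => e \notin G)).
    apply: leq_trans (inner_pairs_multipartite (@turan_part r.-1 n) X).
    by rewrite Xs (prednK r0) -rts addKn.
  rewrite big_split /= sum_const qE bE mulnC leq_add2l.
  by rewrite -inG -addnBA // leq_addr.
have E_density n : theta * 'C(n, 2)%:R <= (turan_number r n)%:R + 1 * n%:R :> R.
  have := turan_number_ge n r0; rewrite -(ler_nat R) natrD !natrM => H.
  have r2 : 0 < 2 * r%:R :> R by rewrite mulr_gt0.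
  rewrite -(ler_pM2l r2) mulrA.
  have -> : 2 * r%:R * theta = 2 * r%:R - 2 :> R.
    by rewrite /theta mulrBr mulr1 -mulrA divff ?mulr1 // gt_eqF.
  have r1 : 1 <= r%:R :> R by rewrite ler1n.
  have n0 : 0 <= n%:R :> R by [].
  have nr : n%:R <= r%:R * n%:R :> R by rewrite ler_peMl.
  move: H; rewrite mulrBl natr_bin2; move: ((turan_number r n)%:R : R) => T.
  nra.
have asym := @regime_asymptotics s q a theta g 1 (turan_number r) s2 theta0 g_le g_sum
  E_lower E_density.
have rho1 : 1 < a.+2%:R / a.+1%:R :> R by rewrite ltr_pdivlMr ?ltr0n // mul1r ltr_nat.
have [|f fo fE] := @asymptotic_form _ a (fun n => cardF n s q) _ rho1 _ asym.
  exists s => // n /= sn; exact: (cardF_gt0 E_lower sn).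
by exists f => //; apply: filterS fE => n ->; rewrite addn2 addn1.
Qed.

End Asymptotics.

(** * Counting independent sets *)

Section IndependentSets.
Variables (R : realType) (V : finType).
Implicit Types (A W : {set V}).

Lemma sum_powerset (x : R) W : \sum_(A : {set V} | A \subset W) x ^+ #|A| = (1 + x) ^+ #|W|.
Proof.
rewrite exprDn (partition_big (fun A : {set V} => inord #|A| : 'I_#|W|.+1) predT) //=.
apply: eq_bigr => i _; rewrite expr1n mul1r -cards_draws -sumr_const.
have inordE (A : {set V}) : A \subset W -> (inord #|A| == i :> 'I__) = (#|A| == i).
  by move=> AW; rewrite -val_eqE /= inordK // ltnS subset_leq_card.
apply: eq_big => [A|A /andP[AW]].
  by rewrite inE; case AW: (A \subset W); rewrite //= inordE.
by rewrite inordE // => /eqP->.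
Qed.

(** The subsets of $W$ with at most $m$ elements. *)
Definition small_subsets m W : {set {set V}} :=
  [set A : {set V} | (A \subset W) && (#|A| <= m)%N].

(** Each subset $A$ with at most $m$ elements contributes at least $x^m$ to the sum of the
    $x^{|A|}$ over all subsets of $W$. *)
Lemma card_small_subsets (x : R) m W : 0 < x <= 1 ->
  #|small_subsets m W|%:R <= x ^- m * (1 + x) ^+ #|W|.
Proof.
case/andP=> x0 x1; rewrite mulrC ler_pdivlMr ?exprn_gt0 // -sum_powerset.
rewrite mulr_natl -sumr_const big_mkcond [leRHS]big_mkcond; apply: ler_sum => A _.
rewrite inE; case: (A \subset W) => //=; case: leqP => Am; last by rewrite exprn_ge0 // ltW.
by apply: ler_wiXn2l => //; exact: ltW.
Qed.

Variables (m : nat) (nb : V -> {set V}) (r bet P : R) (W0 : {set V}).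

(** Independence for the graph with neighbourhoods [nb]. *)
Definition indep A := [forall v in A, [disjoint A & nb v]].
Definition indep_subsets W : {set {set V}} := [set A in small_subsets m W | indep A].

Lemma indep_subsets_split v W : v \in W ->
  (#|indep_subsets W| <=
   #|indep_subsets (W :\ v)| + #|indep_subsets (W :\ v :\: nb v)|)%N.
Proof.
move=> vW; pose Sv := [set A in indep_subsets W | v \in A].
have -> : #|indep_subsets W| = (#|[set A in indep_subsets W | v \notin A]| + #|Sv|)%N.
  rewrite addnC -(cardsID [set A : {set V} | v \in A]).
  by congr (_ + _)%N; apply: eq_card => A; rewrite !inE // andbC.
apply: leq_add.
  apply/subset_leq_card/subsetP => A; rewrite !inE.
  case/andP=> /andP[/andP[AW Am] Ai] vA; rewrite Am Ai subsetD1 vA AW //.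
rewrite -(@card_in_imset _ _ (fun A => A :\ v)); last first.
  move=> A B; rewrite !inE => /andP[_ vA] /andP[_ vB] AB.
  by rewrite -(setD1K vA) -(setD1K vB) AB.
apply/subset_leq_card/subsetP => _ /imsetP[A + ->].
rewrite !inE => /andP[/andP[/andP[AW Am] /forall_inP Ai] vA].
rewrite (leq_trans (subset_leq_card (subsetDl _ _)) Am) andbT; apply/andP; split.
  rewrite subsetD setSD //= (disjointWl (subsetDl _ _)) ?Ai //.
apply/forall_inP => x /setD1P[_ xA].
by rewrite (disjointWl (subsetDl _ _)) ?Ai.
Qed.

Hypothesis bet01 : 0 < bet <= 1.
Hypothesis P_bound : forall W, #|W|%:R <= r -> #|small_subsets m W|%:R <= P.
Hypothesis nb_large : forall W, W \subset W0 -> r < #|W|%:R ->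
  exists2 v, v \in W & bet * #|W|%:R <= #|nb v :&: W|%:R.

(** The container bound of Kleitman and Winston: as long as $W$ is large, some vertex $v$
    has many neighbours in $W$; an independent set that contains $v$ avoids them, so this
    can happen only $k$ times before at most $r$ vertices remain. *)
Lemma indep_subsets_le k W : W \subset W0 -> (1 - bet) ^+ k * #|W|%:R <= r ->
  #|indep_subsets W|%:R <= #|W|.+1%:R ^+ k * P.
Proof.
case/andP: bet01 => bet0 bet1; have bet1' : 0 <= 1 - bet by rewrite subr_ge0.
have base W' : #|W'|%:R <= r -> #|indep_subsets W'|%:R <= P.
  move=> W'r; apply: le_trans (P_bound W'r); rewrite ler_nat subset_leq_card //.
  by apply/subsetP => A; rewrite inE => /andP[].
move: {2}#|W| (leqnn #|W|) => w; elim: w k W => [|w IH] k W Ww WW0 Wr.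
  have W0' : #|W| = 0%N by apply/eqP; rewrite -leqn0.
  rewrite W0' expr1n mul1r; apply: base.
  by move: Wr; rewrite W0' mulr0.
have [Wr'|rW] := leP #|W|%:R r.
  have P0 : 0 <= P by apply: le_trans (base _ Wr').
  by apply: le_trans (base _ Wr') _; rewrite ler_peMl // exprn_ege1 // ler1n.
case: k Wr => [|k] Wr; first by rewrite expr0 mul1r leNgt rW in Wr.
have [v vW vb] := nb_large WW0 rW.
have Wv : #|W :\ v|.+1 = #|W| by rewrite [RHS](cardsD1 v) vW.
have sub1 : W :\ v \subset W by apply: subsetDl.
have sub2 : W :\ v :\: nb v \subset W :\ v by apply: subsetDl.
have := IH k.+1 (W :\ v); rewrite -ltnS Wv => /(_ Ww (subset_trans sub1 WW0)) IH1.
have {}IH1 : #|indep_subsets (W :\ v)|%:R <= #|W|%:R ^+ k.+1 * P.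
  apply: IH1; apply: le_trans Wr; rewrite ler_wpM2l ?exprn_ge0 //.
  by rewrite ler_nat subset_leq_card.
have c2 : (#|W :\ v :\: nb v| <= w)%N.
  by apply: leq_trans (subset_leq_card sub2) _; rewrite -ltnS Wv.
have := IH k (W :\ v :\: nb v) c2 (subset_trans sub2 (subset_trans sub1 WW0)) => IH2.
have {}IH2 : #|indep_subsets (W :\ v :\: nb v)|%:R <=
    #|W :\ v :\: nb v|.+1%:R ^+ k * P.
  apply: IH2; apply: le_trans Wr; rewrite exprSr -mulrA ler_wpM2l ?exprn_ge0 //.
  have c3 : (#|W :\ v :\: nb v| + #|nb v :&: W| <= #|W|)%N.
    by rewrite -[leqRHS](cardsID (nb v) W) addnC setIC leq_add2l subset_leq_card ?setSD.
  by move: c3; rewrite -(ler_nat R) natrD; lra.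
have P0 : 0 <= P.
  apply: le_trans (P_bound (W := set0) _) => //; rewrite cards0.
  by apply: le_trans Wr; rewrite mulr_ge0 ?exprn_ge0.
have := indep_subsets_split vW; rewrite -(ler_nat R) natrD => /le_trans; apply.
apply: le_trans (lerD IH1 IH2) _; rewrite -mulrDl ler_wpM2r //.
have -> : #|W|.+1%:R ^+ k.+1 = #|W|.+1%:R ^+ k * #|W|%:R + #|W|.+1%:R ^+ k :> R.
  by rewrite exprSr -[X in _ * X]natr1 mulrDr mulr1.
apply: lerD; first by rewrite exprSr ler_wpM2r // lerXn2r ?nnegrE ?ler_nat.
rewrite lerXn2r ?nnegrE // ler_nat ltnS subset_leq_card //.
exact: subset_trans sub2 sub1.
Qed.

End IndependentSets.

(** * Graphs in which four vertices span at most three edges *)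

Section FourSparse.
Variable V : finType.
Implicit Types (E H : {set pairs V}) (U W : {set V}) (x y v z : V).

(** Graphs are given by their sets of edges. *)
Definition adj E x y := [exists e in E, val e == [set x; y]].

Lemma adjP E x y : reflect (exists2 e, e \in E & val e = [set x; y]) (adj E x y).
Proof.
apply: (iffP existsP) => [[e /andP[eE /eqP ee]]|[e eE ee]]; first by exists e.
by exists e; rewrite eE ee eqxx.
Qed.

Lemma adjC E x y : adj E x y = adj E y x.
Proof. by rewrite /adj setUC. Qed.

Lemma adj_neq E x y : adj E x y -> x != y.
Proof.
case/adjP => e _ ee; apply/eqP => xy; have := card_pair e.
by rewrite ee xy setUid cards1.
Qed.

(** Any four vertices span at most three edges. *)
Definition four_sparse E :=
  [forall X : {set V}, (#|X| == 4)%N ==> (#|[set e in E | val e \subset X]| <= 3)%N].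

(** Two distinct vertices have at most one common neighbour. *)
Lemma four_sparse_no_c4 E x v y y' : four_sparse E ->
  adj E x y -> adj E x y' -> adj E v y -> adj E v y' -> x != v -> y = y'.
Proof.
move=> E4 xy xy' vy vy' xv; apply: contrapT => /eqP yy'.
have [nxy nxy' nvy nvy'] := And4 (adj_neq xy) (adj_neq xy') (adj_neq vy) (adj_neq vy').
case/adjP: xy => e1 e1E ee1; case/adjP: xy' => e2 e2E ee2.
case/adjP: vy => e3 e3E ee3; case/adjP: vy' => e4 e4E ee4.
pose X := [set x; y; v; y'].
have X4 : #|X| = 4%N.
  rewrite /X (setUC _ [set y']) cardsU1 (setUC _ [set v]) cardsU1 cards2 !inE.
  rewrite [y' == v]eq_sym [y' == x]eq_sym [y' == y]eq_sym [v == x]eq_sym.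
  by rewrite (negPf nvy') (negPf nxy') (negPf yy') (negPf xv) (negPf nvy) (negPf nxy).
have := forallP E4 X; rewrite X4 /= leqNgt => /negP; apply.
have ne (e e' : pairs V) z : z \in val e -> z \notin val e' -> e != e'.
  by move=> ze ze'; apply: contraNneq ze' => <-.
have u4 : uniq [:: e1; e2; e3; e4].
  rewrite /= !inE !negb_or !andbT -!andbA; apply/and3P; split; [| |apply/and4P; split].
  - by apply: (ne _ _ y); rewrite ?ee1 ?ee2 !inE ?eqxx ?orbT // negb_or yy' eq_sym nxy.
  - by apply: (ne _ _ x); rewrite ?ee1 ?ee3 !inE ?eqxx ?orbT // negb_or xv nxy.
  - by apply: (ne _ _ x); rewrite ?ee1 ?ee4 !inE ?eqxx ?orbT // negb_or xv nxy'.
  - by apply: (ne _ _ x); rewrite ?ee2 ?ee3 !inE ?eqxx ?orbT // negb_or xv nxy.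
  - by apply: (ne _ _ x); rewrite ?ee2 ?ee4 !inE ?eqxx ?orbT // negb_or xv nxy'.
  - by apply: (ne _ _ y); rewrite ?ee3 ?ee4 !inE ?eqxx ?orbT // negb_or yy' eq_sym nvy.
rewrite cardE; apply: (uniq_leq_size u4) => e; rewrite mem_enum.
rewrite !inE => /or4P[] /eqP->; rewrite ?e1E ?e2E ?e3E ?e4E /=;
  rewrite ?ee1 ?ee2 ?ee3 ?ee4 subUset !sub1set !inE ?eqxx ?orbT //.
Qed.

Definition nbhd E x : {set V} := [set y | adj E x y].

(** The other vertices having a common neighbour with $v$. *)
Definition second_nbhd E v : {set V} :=
  [set z | (z != v) && [exists x, adj E x v && adj E x z]].

(** All edges lie inside $U$. *)
Definition inside E U := [forall e in E, val e \subset U].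

Lemma inside_adj E U x y : inside E U -> adj E x y -> (x \in U) && (y \in U).
Proof.
move=> /forall_inP EU /adjP[e /EU eU ee]; move: eU.
by rewrite ee subUset !sub1set.
Qed.

(** Distinct common neighbours $x$ of $v$ give disjoint sets of second neighbours. *)
Lemma second_nbhd_ge E W v : four_sparse E ->
  (\sum_(x in nbhd E v) #|(nbhd E x :&: W) :\ v| <= #|second_nbhd E v :&: W|)%N.
Proof.
move=> E4; under eq_bigr do rewrite -sum1_card.
rewrite (exchange_big_dep [in second_nbhd E v :&: W]) /=; last first.
  move=> x z; rewrite !inE => xv /and3P[-> xz ->]; rewrite /= andbT.
  by apply/existsP; exists x; rewrite adjC xv.
rewrite -[leqRHS]sum1_card; apply: leq_sum => z _; rewrite sum1_card.
apply/card_le1_eqP => x x' /andP[vx zx] /andP[vx' zx'].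
move: vx vx' zx zx'; rewrite !inE => vx vx' /and3P[zv xz _] /and3P[_ x'z _].
apply: (four_sparse_no_c4 (x := v) (v := z) E4) => //; first by rewrite adjC.
  by rewrite adjC.
by rewrite eq_sym.
Qed.

Lemma sum_nbhd_large E U W : inside E U -> W \subset U ->
  (\sum_(x in U) #|nbhd E x :&: W| = \sum_(y in W) #|nbhd E y|)%N.
Proof.
move=> EU WU; under eq_bigr do rewrite -sum1_card.
under [RHS]eq_bigr do rewrite -sum1_card.
rewrite (exchange_big_dep [in W]) /=; last by move=> x y _ /setIP[].
apply: eq_bigr => y yW; apply: eq_bigl => x; rewrite !inE yW andbT adjC.
by apply/andP/idP => [[]//|yx]; have /andP[] := inside_adj EU yx.
Qed.

Variable R : realType.

(** In a large set $W$ some vertex has many second neighbours: the pairs of vertices of $W$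
    with a common neighbour $x$ number about $t_x^2/2$, where $t_x$ is the number of
    neighbours of $x$ in $W$, and $x$ is determined by the pair. *)
Lemma second_nbhd_large E U W (D : nat) : four_sparse E -> inside E U -> W \subset U ->
  (forall y, y \in U -> (D <= #|nbhd E y|)%N) -> (0 < D)%N ->
  4 * #|U|%:R < D%:R * #|W|%:R :> R ->
  exists2 v, v \in W &
    D%:R ^+ 2 * #|W|%:R <= 2 * #|U|%:R * #|second_nbhd E v :&: W|%:R :> R.
Proof.
move=> E4 EU WU degD D0 large; apply: contrapT => no.
have W0 : (0 < #|W|)%N.
  rewrite lt0n; apply/negP => /eqP W0; move: large; rewrite W0 mulr0.
  by apply/negP; rewrite -leNgt mulr_ge0.
have U0 : (0 < #|U|)%N by apply: leq_trans W0 (subset_leq_card WU).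
set u : R := #|U|%:R; have u0 : 0 < u by rewrite ltr0n.
set w : R := #|W|%:R; have w0 : 0 < w by rewrite ltr0n.
pose t x := #|nbhd E x :&: W|.
have upper : 2 * u * (\sum_(v in W) #|second_nbhd E v :&: W|)%:R < D%:R ^+ 2 * w * w.
  rewrite natr_sum mulr_sumr [ltRHS]mulr_natr -sumr_const.
  apply: ltr_sum => [|v vW]; last by rewrite ltNge; apply/negP => le; apply: no; exists v.
  by case/card_gt0P: W0 => v vW; apply/hasP; exists v; rewrite ?mem_index_enum.
have lower : (\sum_(x in U) t x * (t x - 1) <= \sum_(v in W) #|second_nbhd E v :&: W|)%N.
  apply: leq_trans (leq_sum _ (fun v _ => second_nbhd_ge W v E4)).
  rewrite (exchange_big_dep [in U]) /=; last first.
    by move=> v x vW; rewrite inE => vx; have /andP[] := inside_adj EU vx.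
  apply: leq_sum => x xU; rewrite -[leqLHS]sum_nat_const.
  rewrite [leqLHS]big_mkcond [leqRHS]big_mkcond; apply: leq_sum => v _.
  rewrite !inE [adj E v x]adjC; case vW: (v \in W); rewrite ?andbF //= andbT.
  case: ifP => // xv; rewrite leq_subLR /t (cardsD1 v) leq_add2r.
  by rewrite inE; case: (_ && _).
have sum_t : D%:R * w <= \sum_(x in U) (t x)%:R.
  rewrite -natr_sum sum_nbhd_large // -natrM ler_nat mulnC -sum_nat_const.
  by apply: leq_sum => y /(subsetP WU)/degD.
pose tau := D%:R * w / u.
have tau4 : 4 < tau by rewrite ltr_pdivlMr.
have tauE : tau * u = D%:R * w by rewrite divfK ?gt_eqF.
have : (2 * tau - 1) * (D%:R * w) - tau ^+ 2 * u <= (\sum_(x in U) t x * (t x - 1))%:R.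
  apply: (@le_trans _ _ (\sum_(x in U) ((2 * tau - 1) * (t x)%:R - tau ^+ 2))).
    rewrite sumrB -mulr_sumr sumr_const -[tau ^+ 2 *+ _]mulr_natr lerD2r ler_wpM2l //; lra.
  rewrite natr_sum; apply: ler_sum => x _.
  have -> : (t x * (t x - 1))%:R = (t x)%:R * (t x)%:R - (t x)%:R :> R.
    by case: (t x) => [|k]; rewrite ?mul0n ?mul0r ?subr0 // subn1 /= natrM -[k.+1%:R]natr1; ring.
  have := sqr_ge0 ((t x)%:R - tau); lra.
move: upper lower; rewrite -tauE -(ler_nat R).
have -> : D%:R ^+ 2 * w * w = (tau * u) ^+ 2 by rewrite tauE; ring.
move=> upper l1 l2; have := le_trans l2 l1; have u2 : 0 < 2 * u by rewrite mulr_gt0.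
rewrite -(ler_pM2l u2) => /le_lt_trans/(_ upper); apply/negP; rewrite -leNgt.
have -> : 2 * u * ((2 * tau - 1) * (tau * u) - tau ^+ 2 * u)
    = (tau * u) ^+ 2 + (tau * u * u) * (tau - 2) by ring.
have tau0 : 0 <= tau by lra.
rewrite lerDl; apply: mulr_ge0; last by lra.
by rewrite (mulr_ge0 (mulr_ge0 tau0 (ltW u0)) (ltW u0)).
Qed.

(** The four-sparse graphs with vertex set $U$. *)
Definition family U : {set {set pairs V}} := [set E | four_sparse E && inside E U].

(** The largest lower bound for the degrees of $H$ in $U$. *)
Definition min_degree H U : nat :=
  \max_(d < #|V|.+1 | [forall y in U, d <= #|nbhd H y|]%N) d.

Lemma min_degree_le H U y : y \in U -> (min_degree H U <= #|nbhd H y|)%N.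
Proof.
move=> yU; have [|d dP dE] := @eq_bigmax_cond _
  [pred d : 'I_#|V|.+1 | [forall y in U, d <= #|nbhd H y|]%N] (@nat_of_ord _).
  by apply/card_gt0P; exists ord0; rewrite inE; apply/forall_inP.
rewrite /min_degree dE; move: dP; rewrite inE => /forall_inP; exact.
Qed.

Lemma le_min_degree H U d : (d <= #|V|)%N ->
  (forall y, y \in U -> (d <= #|nbhd H y|)%N) -> (d <= min_degree H U)%N.
Proof.
move=> dV dP; rewrite -ltnS in dV.
by apply: (leq_bigmax_cond (Ordinal dV)); apply/forall_inP.
Qed.

Definition remove_vertex E v : {set pairs V} := [set e in E | v \notin val e].

Lemma adj_remove E v x y : adj (remove_vertex E v) x y = [&& adj E x y, x != v & y != v].
Proof.
apply/adjP/and3P => [[e]|[/adjP[e eE ee] xv yv]].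
  rewrite inE => /andP[eE]; move=> + ee; rewrite ee !inE negb_or => /andP[vx vy].
  by rewrite ![_ == v]eq_sym vx vy; split=> //; apply/adjP; exists e.
by exists e; rewrite // inE eE ee !inE negb_or ![v == _]eq_sym xv yv.
Qed.

Lemma family_remove E U v : E \in family U -> remove_vertex E v \in family (U :\ v).
Proof.
rewrite !inE => /andP[/forallP E4 /forall_inP EU]; apply/andP; split.
  apply/forallP => X; apply/implyP => X4; have := E4 X; rewrite X4 /=.
  apply: leq_trans; apply/subset_leq_card/subsetP => e; rewrite !inE.
  by move=> /andP[/andP[-> _] ->].
by apply/forall_inP => e; rewrite inE => /andP[/EU eU ve]; rewrite subsetD1 eU.
Qed.

(** The candidates for the neighbourhood of a new vertex which is joined to $H$ without
    creating a 4-cycle and has minimum degree in the resulting graph. *)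
Definition extensions H U : {set {set V}} :=
  indep_subsets (min_degree H U).+1 (second_nbhd H) U.

(** Two neighbours of $v$ have no other common neighbour, and their number exceeds no degree
    in the remaining graph by more than one. *)
Lemma nbhd_min_extension E U v : E \in family U -> v \in U ->
  (forall y, y \in U -> (#|nbhd E v| <= #|nbhd E y|)%N) ->
  nbhd E v \in extensions (remove_vertex E v) (U :\ v).
Proof.
rewrite inE => /andP[E4 EU] vU vmin; rewrite !inE; apply/andP; split; last first.
  apply/forall_inP => y; rewrite inE => vy; rewrite -setI_eq0; apply/set0Pn => -[z].
  rewrite !inE => /andP[vz /andP[zy /existsP[x]]].
  rewrite !adj_remove => /andP[/and3P[xy xv _] /and3P[xz _ _]].
  by move/eqP: zy; apply; apply: (four_sparse_no_c4 E4 vz vy xz xy); rewrite eq_sym.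
apply/andP; split.
  apply/subsetP => y; rewrite !inE => vy; have /andP[_ ->] := inside_adj EU vy.
  by rewrite andbT eq_sym (adj_neq vy).
rewrite -[leqLHS](subnKC (_ : 0 <= _)%N) // add0n.
have [->//|dv] := posnP #|nbhd E v|; rewrite -(prednK dv) ltnS.
apply: le_min_degree; first by apply: leq_trans (leq_pred _) (max_card _).
move=> y /setD1P[yv yU]; rewrite -ltnS (prednK dv).
apply: leq_trans (vmin y yU) _; rewrite (cardsD1 v (nbhd E y)).
rewrite -add1n leq_add ?leq_b1 //.
apply: subset_leq_card; apply/subsetP => z; rewrite !inE adj_remove.
by case/andP=> -> ->; rewrite yv.
Qed.

Lemma remove_vertex_inj E E' v :
  remove_vertex E v = remove_vertex E' v -> nbhd E v = nbhd E' v -> E = E'.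
Proof.
move=> /setP rE /setP nE; apply/setP => e; have [ve|ve] := boolP (v \in val e); last first.
  by have := rE e; rewrite !inE ve !andbT.
have [y _ ee] := pair_other ve; have := nE y; rewrite !inE.
have adjE (G : {set pairs V}) : adj G v y = (e \in G).
  apply/adjP/idP => [[e' e'G e'E]|eG]; last by exists e.
  by rewrite (_ : e = e') //; apply: val_inj; rewrite ee.
by rewrite !adjE.
Qed.

(** A graph is recovered from a vertex $v$ of minimum degree, the graph $H$ left by removing
    $v$, and the neighbourhood of $v$, which is an extension of $H$. *)
Lemma card_family_rec U (M B : R) : (0 < #|U|)%N -> 0 <= B ->
  (forall v, v \in U -> #|family (U :\ v)|%:R <= M) ->
  (forall v H, v \in U -> H \in family (U :\ v) ->
     #|extensions H (U :\ v)|%:R <= B) ->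
  #|family U|%:R <= #|U|%:R * (M * B).
Proof.
move=> U0 B0 famM extB; case/card_gt0P: U0 => v0 v0U.
pose vmin E := [arg min_(v < v0 in U) #|nbhd E v|].
have vminP E : vmin E \in U /\ forall y, y \in U -> (#|nbhd E (vmin E)| <= #|nbhd E y|)%N.
  by rewrite /vmin; case: arg_minnP.
have fam_v v : v \in U -> #|[set E in family U | vmin E == v]|%:R <= M * B.
  move=> vU.
  pose S := [set p : {set pairs V} * {set V} |
    (p.1 \in family (U :\ v)) && (p.2 \in extensions p.1 (U :\ v))].
  have inj : {in [set E in family U | vmin E == v] &,
      injective (fun E => (remove_vertex E v, nbhd E v))}.
    by move=> E E' _ _ [rE nE]; apply: remove_vertex_inj rE nE.
  rewrite -(card_in_imset inj); apply: (@le_trans _ _ #|S|%:R).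
    rewrite ler_nat; apply: subset_leq_card; apply/subsetP => _ /imsetP[E + ->].
    rewrite inE => /andP[EU /eqP vE]; rewrite inE /= family_remove //=.
    by have [_ minE] := vminP E; rewrite vE in minE; apply: nbhd_min_extension.
  have -> : #|S| = (\sum_(H in family (U :\ v)) #|extensions H (U :\ v)|)%N.
    rewrite -sum1_card (eq_bigl (fun p => (p.1 \in family (U :\ v)) &&
       (p.2 \in extensions p.1 (U :\ v)))) => [|p]; last by rewrite inE.
    rewrite -(pair_big_dep [in family (U :\ v)] (fun H A => A \in extensions H (U :\ v))
      (fun _ _ => 1%N)) /=.
    by apply: eq_bigr => H _; rewrite sum1_card.
  rewrite natr_sum; apply: (@le_trans _ _ (\sum_(H in family (U :\ v)) B)).
    by apply: ler_sum => H Hf; apply: extB.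
  by rewrite sumr_const -[_ *+ _]mulr_natl ler_wpM2r // famM.
have -> : #|family U| = (\sum_(v in U) #|[set E in family U | vmin E == v]|)%N.
  rewrite -sum1_card (partition_big vmin [in U]) /=; last by move=> E _; case: (vminP E).
  by apply: eq_bigr => v _; rewrite -sum1_card; apply: eq_bigl => E; rewrite inE.
rewrite natr_sum mulr_natl -sumr_const; apply: ler_sum => v; exact: fam_v.
Qed.

End FourSparse.

(** * The Kleitman-Winston bound *)

Section KleitmanWinston.
Variable R : realType.

Lemma ln_le_id (x : R) : 0 < x -> ln x <= x.
Proof.
move=> x0; have := @le_ln1Dx R (x - 1).
have -> : 1 + (x - 1) = x by ring.
by move=> H; apply: le_trans (H _) _; lra.
Qed.

Variable V : finType.
Implicit Types (H : {set pairs V}) (U W : {set V}).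

Lemma card_small_subsets_expR (x : R) m W : 0 < x <= 1 ->
  #|small_subsets m W|%:R <= expR (- (m%:R * ln x) + x * #|W|%:R).
Proof.
move=> x01; have /andP[x0 x1] := x01; apply: le_trans (card_small_subsets m W x01) _.
rewrite expRD; apply: ler_pM.
- by rewrite invr_ge0 exprn_ge0 // ltW.
- by rewrite exprn_ge0 // addr_ge0 // ltW.
- by rewrite expRN mulr_natl -lnXn // lnK // posrE exprn_gt0.
- rewrite expRM_natr lerXn2r ?nnegrE ?expR_ge0 ?addr_ge0 ?(ltW x0) //.
  exact: expR_ge1Dx.
Qed.

(** Write $u = |U| = y^8$ and let $D$ be the minimum degree. If $D \le y^3$, then already the
    number of all sets of at most $D + 1$ vertices is small. Otherwise every set $W$ of more
    than $4u/D$ vertices contains a vertex with at least $|W|/2y^2$ second neighbours in $W$,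
    and the container bound leaves sets of at most $D + 1$ vertices out of $4u/D$. *)
Lemma card_extensions H U (y : R) : four_sparse H -> inside H U ->
  1 <= y -> y ^+ 8 = #|U|%:R ->
  #|extensions H U|%:R <= expR (159 * y ^+ 4).
Proof.
move=> H4 HU y1 yU; pose u : R := #|U|%:R.
have y0 : 0 < y by apply: lt_le_trans y1.
have u0 : 0 < u by rewrite /u -yU exprn_gt0.
have yX i j : (i <= j)%N -> y ^+ i <= y ^+ j by move=> ij; apply: ler_weXn2l.
have y41 : 1 <= y ^+ 4 by apply: exprn_ege1.
have ln_u : ln u <= 8 * y.
  by rewrite /u -yU lnXn // -[_ *+ _]mulr_natl ler_wpM2l // ln_le_id.
have sub_small : #|extensions H U|%:R <= #|small_subsets (min_degree H U).+1 U|%:R :> R.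
  by rewrite ler_nat; apply/subset_leq_card/subsetP => A; rewrite inE => /andP[].
set D := min_degree H U in sub_small *.
have /card_gt0P[z0 z0U] : (0 < #|U|)%N by rewrite -(ltr_nat R).
have DU : D%:R <= u.
  rewrite ler_nat; apply: leq_trans (min_degree_le H z0U) (subset_leq_card _).
  by apply/subsetP => z; rewrite inE => zz; have /andP[] := inside_adj HU zz.
have [Dsmall|Dlarge] := leP (D%:R : R) (y ^+ 3).
  (* the free parameter x = 1 / u yields at most e u ^ (D + 1) sets *)
  apply: le_trans sub_small _.
  have u1 : 0 < u^-1 <= 1.
    by rewrite invr_gt0 u0 invf_le1 // /u ler1n -(ltr_nat R).
  apply: le_trans (card_small_subsets_expR _ _ u1) _; rewrite ler_expR -/u mulVf ?gt_eqF //.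
  rewrite lnV ?posrE // mulrN opprK -natr1.
  have : (D%:R + 1) * ln u <= (y ^+ 3 + y ^+ 3) * (8 * y).
    apply: ler_pM => //; first by rewrite ln_ge0 // /u -yU exprn_ege1.
    by rewrite lerD // exprn_ege1.
  have -> : (y ^+ 3 + y ^+ 3) * (8 * y) = 16 * y ^+ 4 by ring.
  lra.
have D0 : 0 < (D%:R : R) by apply: lt_trans Dlarge; rewrite exprn_gt0.
pose bet := (2 * y ^+ 2)^-1.
have bet01 : 0 < bet <= 1.
  have y21 : 1 <= y ^+ 2 by apply: exprn_ege1.
  by rewrite invr_gt0 mulr_gt0 ?exprn_gt0 //= invf_le1 ?mulr_gt0 ?exprn_gt0 //; lra.
pose r := 4 * u / D%:R.
have P_bound W : #|W|%:R <= r -> #|small_subsets D.+1 W|%:R <= expR (6 * y ^+ 4).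
  move=> Wr; have [Dy|yD] := ltP (D%:R : R) (y ^+ 4).
    have x01 : 0 < D%:R / y ^+ 4 <= 1.
      by rewrite divr_gt0 ?exprn_gt0 //= ler_pdivrMr ?exprn_gt0 // mul1r ltW.
    apply: le_trans (card_small_subsets_expR _ _ x01) _; rewrite ler_expR.
    have xW : D%:R / y ^+ 4 * #|W|%:R <= 4 * y ^+ 4.
      have /andP[x0 _] := x01; apply: le_trans (ler_wpM2l (ltW x0) Wr) _.
      rewrite le_eqVlt; apply/orP; left; apply/eqP.
      by rewrite /r /u -yU; field; rewrite !gt_eqF.
    (* ln z <= z at z = y ^ 4 / D *)
    have : D.+1%:R * - ln (D%:R / y ^+ 4) <= 2 * y ^+ 4.
      rewrite -lnV ?posrE ?divr_gt0 ?exprn_gt0 // invf_div.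
      have q0 : 0 <= ln (y ^+ 4 / D%:R).
        by rewrite ln_ge0 // ler_pdivlMr // mul1r ltW.
      have q1 : ln (y ^+ 4 / D%:R) <= y ^+ 4 / D%:R.
        by rewrite ln_le_id // divr_gt0 ?exprn_gt0.
      have D2 : D.+1%:R <= 2 * D%:R :> R.
        by rewrite -natr1 mulrDl mul1r lerD2l // ler1n -(ltr_nat R).
      apply: (@le_trans _ _ (2 * D%:R * (y ^+ 4 / D%:R))); first exact: ler_pM.
      by rewrite -mulrA [D%:R * _]mulrC divfK ?gt_eqF.
    by rewrite mulrN; lra.
  have one01 : 0 < (1 : R) <= 1 by rewrite ltr01 lexx.
  apply: le_trans (card_small_subsets_expR _ _ one01) _.
  rewrite ler_expR ln1 mulr0 oppr0 add0r mul1r; apply: le_trans Wr _.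
  rewrite ler_pdivrMr // /u -yU.
  have : y ^+ 4 * y ^+ 4 <= y ^+ 4 * D%:R by rewrite ler_wpM2l // exprn_ge0 // ltW.
  rewrite -exprD; nra.
have nb_large W : W \subset U -> r < #|W|%:R ->
    exists2 v, v \in W & bet * #|W|%:R <= #|second_nbhd H v :&: W|%:R.
  move=> WU rW; have [|||v vW vb] := @second_nbhd_large V R H U W D H4 HU WU _ _.
  - by move=> z; apply: min_degree_le.
  - by rewrite -(ltr_nat R).
  - by rewrite [ltRHS]mulrC -ltr_pdivrMr.
  exists v => //; rewrite -(ler_pM2l (_ : 0 < 2 * u)) ?mulr_gt0 //.
  apply: le_trans vb; rewrite mulrA ler_wpM2r //.
  have -> : 2 * u * bet = y ^+ 6 by rewrite /bet /u -yU; field; rewrite gt_eqF.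
  have -> : y ^+ 6 = y ^+ 3 ^+ 2 by rewrite -exprM.
  by rewrite lerXn2r ?nnegrE ?exprn_ge0 ?ltW.
(* bet * k >= 8 y >= ln u, so that after k steps at most one vertex is left *)
have [k /andP[k1 k2]] : exists k : nat, 16 * y ^+ 3 <= k%:R <= 17 * y ^+ 3.
  have t0 : 0 <= 16 * y ^+ 3 by rewrite mulr_ge0 // exprn_ge0 // ltW.
  have /andP[t1 t2] := truncn_itv t0.
  eexists; apply/andP; split; first exact: ltW t2.
  rewrite -natr1; have : 1 <= y ^+ 3 by apply: exprn_ege1.
  by move: t1; lra.
have kr : (1 - bet) ^+ k * #|U|%:R <= r.
  apply: (@le_trans _ _ 1); last first.
    by rewrite /r ler_pdivlMr // mul1r; lra.
  have /andP[b0 b1] := bet01.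
  rewrite -[X in _ * X](lnK u0) -/u.
  apply: (@le_trans _ _ (expR (- bet) ^+ k * expR (ln u))).
    rewrite ler_wpM2r ?expR_ge0 // lerXn2r ?nnegrE ?subr_ge0 ?expR_ge0 //.
    exact: expR_ge1Dx.
  rewrite -expRM_natl -expRD -[leRHS]expR0 ler_expR.
  have : bet * (16 * y ^+ 3) <= bet * k%:R by rewrite ler_wpM2l // ltW.
  have -> : bet * (16 * y ^+ 3) = 8 * y by rewrite /bet; field; rewrite gt_eqF.
  rewrite mulrN [k%:R * _]mulrC; lra.
have := indep_subsets_le bet01 P_bound nb_large (subxx U) kr => /le_trans; apply.
have -> : 159 * y ^+ 4 = 17 * y ^+ 3 * (9 * y) + 6 * y ^+ 4 by ring.
rewrite expRD ler_pM2r ?expR_gt0 // -[X in X ^+ k]lnK ?posrE ?ltr0n //.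
rewrite -expRM_natl ler_expR.
apply: ler_pM => //; first by rewrite ln_ge0 // ler1n.
apply: (@le_trans _ _ (ln (2 * u))).
  rewrite ler_ln ?posrE; [|by rewrite ltr0n|by rewrite mulr_gt0].
  by rewrite -natr1 mulrDl mul1r lerD2l /u -yU exprn_ege1.
have ln2 : ln (2 : R) <= 1.
  by have := @le_ln1Dx R 1; rewrite (_ : 1 + 1 = 2) //; apply; lra.
have p2 : (2 : R) \is Num.pos by rewrite posrE.
have -> : ln (2 * u) = ln 2 + ln u by exact: lnM p2 u0.
lra.
Qed.

End KleitmanWinston.

(** * The multigraphs with at most three edges on four vertices *)

Section FourThreeUpper.
Variable R : realType.

(** Powers of an eighth root of $n$ replace the fractional powers of $n$. *)
Lemma exists_root8 (n : nat) : exists y : R,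
  [/\ 0 <= y, y ^+ 8 = n%:R & (0 < n)%N -> 1 <= y].
Proof.
pose y : R := n%:R `^ (8%:R^-1); have y0 : 0 <= y by apply: powR_ge0.
have y8 : y ^+ 8 = n%:R by rewrite -powR_mulrn // -powRrM mulVf ?pnatr_eq0 // powRr1.
exists y; split=> // n0; rewrite -(@ler_pXn2r _ 8) ?nnegrE //.
by rewrite y8 expr1n ler1n.
Qed.

Section Family.
Variables (V : finType) (n : nat) (Y : R).
Hypothesis Y1 : 1 <= Y.
Hypothesis Y8 : Y ^+ 8 = n%:R.
Implicit Types U : {set V}.

Lemma card_family_le U : (#|U| <= n)%N ->
  #|family U|%:R <= expR (#|U|%:R * (8 * Y + 159 * Y ^+ 4)).
Proof.
have Y0 : 0 < Y by apply: lt_le_trans Y1.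
set L := _ + _; move: {2}#|U| (erefl #|U|) => m; elim: m U => [|m IH] U Um Un.
  have one : 1 = #|[set set0 : {set pairs V}]|%:R :> R by rewrite cards1.
  rewrite Um mul0r expR0 [leRHS]one ler_nat.
  apply: subset_leq_card; apply/subsetP => E; rewrite !inE => /andP[_ /forall_inP EU].
  apply/eqP/setP => e; rewrite inE; apply/negP => /EU.
  by rewrite (cards0_eq Um) subset0 => /eqP e0; have := card_pair e; rewrite e0 cards0.
have U0 : (0 < #|U|)%N by rewrite Um.
have B0 : 0 <= expR (159 * Y ^+ 4) by apply: expR_ge0.
have card_D1 v : v \in U -> #|U :\ v| = m.
  by move=> vU; have := cardsD1 v U; rewrite vU Um => -[].
apply: le_trans (@card_family_rec V R U (expR (m%:R * L)) _ U0 B0 _ _) _.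
- move=> v vU; have := IH _ (card_D1 v vU); rewrite card_D1 //; apply.
  by rewrite ltnW // -Um.
- move=> v H vU; rewrite inE => /andP[H4 HU].
  have [y [y0 y8 y1]] := exists_root8 m.
  have [m0|m0] := posnP m.
    apply: (@le_trans _ _ 1).
      have one : 1 = #|[set set0 : {set V}]|%:R :> R by rewrite cards1.
      rewrite [leRHS]one ler_nat; apply: subset_leq_card.
      apply/subsetP => A; rewrite !inE => /andP[/andP[+ _] _].
      by rewrite (cards0_eq (_ : #|U :\ v| = 0)%N) ?subset0 // card_D1.
    by rewrite -[leLHS]expR0 ler_expR mulr_ge0 // exprn_ge0 // ltW.
  apply: le_trans (card_extensions H4 HU (y1 m0) _) _; first by rewrite card_D1.
  rewrite ler_expR ler_wpM2l // lerXn2r ?nnegrE //; first exact: ltW.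
  rewrite -(@ler_pXn2r _ 8) ?nnegrE //; last exact: ltW.
  by rewrite y8 Y8 ler_nat ltnW // -Um.
rewrite Um -expRD -[X in X * _]lnK ?posrE ?ltr0n // -expRD ler_expR.
have : ln (m.+1%:R : R) <= 8 * Y.
  apply: (@le_trans _ _ (ln (n%:R : R))).
    by rewrite ler_ln ?posrE ?ltr0n ?ler_nat -?Um // (leq_trans U0).
  by rewrite -Y8 lnXn // -[_ *+ _]mulr_natl ler_wpM2l // ln_le_id.
rewrite -natr1 mulrDl mul1r /L; lra.
Qed.

End Family.

(** A multigraph is determined by its three level sets, which are four-sparse graphs. *)
Lemma card_sparse_array43 n :
  (#|{: sparse_array 'I_n 4 3}| <= #|family [set: 'I_n]| ^ 3)%N.
Proof.
pose level k (w : sparse_array 'I_n 4 3) := [set e | k <= entries w e]%N.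
have level_family k w : (0 < k)%N -> level k w \in family [set: 'I_n].
  move=> k0; rewrite inE; apply/andP; split; last first.
    by apply/forall_inP => e _; apply: subsetT.
  apply/forallP => X; apply/implyP => X4; have := forallP (valP w) X; rewrite X4 /=.
  apply: leq_trans; rewrite /weight -sum1_card big_mkcond [leqRHS]big_mkcond.
  apply: leq_sum => e _; rewrite !inE; case: (_ \subset _); rewrite ?andbF // andbT.
  by rewrite ffunE; case: ifP => // ke; apply: leq_trans k0 ke.
pose S := setX (family [set: 'I_n]) (setX (family [set: 'I_n]) (family [set: 'I_n])).
have -> : (#|family [set: 'I_n]| ^ 3 = #|S|)%N by rewrite !cardsX.
pose f w := (level 1%N w, (level 2 w, level 3 w)).
have f_inj : injective f.
  move=> w w' [/setP l1 /setP l2 /setP l3]; apply/val_inj/ffunP => e; apply/val_inj.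
  have := l1 e; have := l2 e; have := l3 e; rewrite !inE /entries.
  have := ltn_ord (val w e); have := ltn_ord (val w' e).
  move: (val w e) (val w' e) => [i /= _] [j /= _]; lia.
rewrite -(card_imset _ f_inj); apply: subset_leq_card; apply/subsetP => _ /imsetP[w _ ->].
by rewrite !in_setX !level_family.
Qed.

Lemma ln_cardF43_le n (Y : R) : (4 <= n)%N -> 1 <= Y -> Y ^+ 8 = n%:R ->
  ln (cardF n 4 3)%:R <= 501 * Y ^+ 12.
Proof.
move=> n4 Y1 Y8; have Y0 : 0 < Y by apply: lt_le_trans Y1.
have card0 : (0 < cardF n 4 3)%N.
  by rewrite cardF_sparse_array // -(ltr_nat R) sparse_array_gt0.
have fam := @card_family_le 'I_n n Y Y1 Y8 setT; rewrite cardsT card_ord in fam.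
have {}fam := fam (leqnn n).
have fam3 : (cardF n 4 3)%:R <= expR (n%:R * (8 * Y + 159 * Y ^+ 4)) ^+ 3.
  apply: le_trans (_ : _ <= (#|family [set: 'I_n]| ^ 3)%:R) _.
    by rewrite ler_nat cardF_sparse_array // card_sparse_array43.
  by rewrite natrX lerXn2r ?nnegrE ?expR_ge0.
apply: (@le_trans _ _ (ln (expR (n%:R * (8 * Y + 159 * Y ^+ 4)) ^+ 3))).
  by rewrite ler_ln ?posrE ?exprn_gt0 ?expR_gt0 ?ltr0n.
rewrite -expRM_natl expRK -Y8.
have -> : Y ^+ 12 = Y ^+ 8 * Y ^+ 4 by rewrite -exprD.
have : Y <= Y ^+ 4 by rewrite -[leLHS]expr1; apply: ler_weXn2l.
move/(ler_wpM2l (exprn_ge0 8 (ltW Y0))); lra.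
Qed.

End FourThreeUpper.

(** * The point-line incidence graph of an affine plane *)

Section Incidence.
Variables (Fq : finFieldType) (n : nat).
Local Notation Q := #|{: Fq}|.
Hypothesis n_large : (2 * Q ^ 2 <= n)%N.
Local Notation point := (Fq * Fq)%type.
Local Notation vertex := (point + point)%type.

(** The point $(x, y)$ lies on the line $y = mx + b$, represented by $(m, b)$. *)
Definition incident (p l : point) := p.2 == l.1 * p.1 + l.2.

Lemma two_points_one_line p p' l l' : incident p l -> incident p l' ->
  incident p' l -> incident p' l' -> p != p' -> l = l'.
Proof.
case: p p' l l' => [x y] [x' y'] [m b] [m' b']; rewrite /incident /=.
move=> /eqP-> /eqP E /eqP-> /eqP E' ne.
have xx' : x - x' != 0.
  by apply: contraNneq ne => /eqP; rewrite subr_eq0 => /eqP->.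
have mm : m = m'.
  have : (m - m') * (x - x') = 0.
    have -> : (m - m') * (x - x') =
      (m * x + b - (m' * x + b')) - (m * x' + b - (m' * x' + b')) by ring.
    by rewrite E E' !subrr.
  by move/eqP; rewrite mulf_eq0 (negPf xx') orbF subr_eq0 => /eqP.
by move: E; rewrite mm => /addrI->.
Qed.

Lemma card_vertex_le : (#|{: vertex}| <= n)%N.
Proof. by apply: leq_trans n_large; rewrite card_sum card_prod mul2n -addnn mulnn. Qed.

Definition index_vertex (t : vertex) : 'I_n := widen_ord card_vertex_le (enum_rank t).

Lemma index_vertex_inj : injective index_vertex.
Proof. by move=> t t' /(congr1 val) /= /val_inj/enum_rank_inj. Qed.

Fact flag_pair_subproof (f : point * point) :
  #|[set index_vertex (inl f.1); index_vertex (inr f.2)]| == 2%N.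
Proof. by rewrite cards2 (inj_eq index_vertex_inj). Qed.

(** The edge joining a point and a line; [index_vertex] numbers the points and lines. *)
Definition flag_pair f : pairs 'I_n :=
  exist (fun e : {set 'I_n} => #|e| == 2%N) _ (flag_pair_subproof f).

Lemma flag_pair_inj : injective flag_pair.
Proof.
move=> [p l] [p' l'] /(congr1 val) /= /setP E.
have := E (index_vertex (inl p)); rewrite !inE eqxx /= !(inj_eq index_vertex_inj) orbF.
move/esym/eqP => [->]; have := E (index_vertex (inr l)).
by rewrite !inE eqxx orbT /= !(inj_eq index_vertex_inj) /= => /esym/eqP [->].
Qed.

(** The incident pairs of a point and a line. *)
Definition incidences : {set point * point} := [set f | incident f.1 f.2].
(** The incidence graph, its vertices being numbered in $\{0, \dots, n - 1\}$. *)
Definition incidence_graph : {set pairs 'I_n} := flag_pair @: incidences.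

Lemma card_incidence_graph : (Q ^ 3 <= #|incidence_graph|)%N.
Proof.
rewrite card_imset; last exact: flag_pair_inj.
have -> : (Q ^ 3 = #|{: Fq * Fq * Fq}|)%N by rewrite !card_prod !expnS expn0 muln1 mulnA.
pose g (t : Fq * Fq * Fq) : point * point :=
  ((t.1.1, t.1.2 * t.1.1 + t.2), (t.1.2, t.2)).
have g_inj : injective g by move=> [[x m] b] [[x' m'] b'] /= [-> _ -> ->].
rewrite -cardsT -(card_imset _ g_inj); apply: subset_leq_card.
by apply/subsetP => _ /imsetP[t _ ->]; rewrite inE /incident eqxx.
Qed.

(** Four vertices of the incidence graph span at most three edges: with two points and two
    lines, four edges would put two points on two common lines. *)
Lemma incidence_graph_sparse (X : {set 'I_n}) : #|X| = 4%N ->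
  (\sum_(e : pairs 'I_n | val e \subset X) (e \in incidence_graph) <= 3)%N.
Proof.
move=> X4.
pose A := [set p : point | index_vertex (inl p) \in X].
pose B := [set l : point | index_vertex (inr l) \in X].
have AB : (#|A| + #|B| <= 4)%N.
  rewrite -X4 -(@card_imset _ _ (index_vertex \o inl) A); last first.
    by move=> p p' /= /index_vertex_inj [].
  rewrite -(@card_imset _ _ (index_vertex \o inr) B); last first.
    by move=> p p' /= /index_vertex_inj [].
  rewrite -cardsUI (_ : _ :&: _ = set0) ?cards0 ?addn0; last first.
    apply/setP => i; rewrite !inE; apply/negP => /andP[/imsetP[p _ ->] /imsetP[l _ /=]].
    by move/index_vertex_inj.
  apply: subset_leq_card; rewrite subUset; apply/andP; split.
    by apply/subsetP => _ /imsetP[p + ->]; rewrite inE.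
  by apply/subsetP => _ /imsetP[p + ->]; rewrite inE.
pose S := setX A B :&: incidences.
apply: (@leq_trans #|S|).
  rewrite -(card_imset (mem S) flag_pair_inj) -sum1_card big_mkcond [leqRHS]big_mkcond.
  apply: leq_sum => e _; case eX: (val e \subset X) => //.
  case eI: (e \in incidence_graph) => //.
  case/imsetP: eI eX => f fI -> fX; rewrite ifT //; apply: imset_f.
  move: fX fI; case: f => p l; rewrite /= subUset !sub1set => /andP[pX lX] plI.
  by rewrite inE plI andbT in_setX !inE pX.
have SA : (#|S| <= #|A| * #|B|)%N by rewrite -cardsX subset_leq_card // subsetIl.
rewrite leqNgt; apply/negP => S4.
have A2 : #|A| = 2%N /\ #|B| = 2%N.
  by move: (leq_trans S4 SA) AB; case: #|A| => [|[|[|[|[|a]]]]]; case: #|B| => [|[|[|[|[|b]]]]].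
case: A2 => A2 B2.
have SE : S = setX A B.
  by apply/eqP; rewrite eqEcard subsetIl cardsX A2 B2.
have /cards2P[p [p' [pp' AE]]] : #|A| == 2%N by rewrite A2.
have /cards2P[l [l' [ll' BE]]] : #|B| == 2%N by rewrite B2.
have inc x y : x \in A -> y \in B -> incident x y.
  move=> xA yB; have : (x, y) \in S by rewrite SE in_setX xA.
  by rewrite inE => /andP[_]; rewrite inE.
move/eqP: ll'; apply; apply: (two_points_one_line (p := p) (p' := p')) => //;
  by apply: inc; rewrite ?AE ?BE ?set21 ?set22.
Qed.

End Incidence.

(** * The order of magnitude for four vertices and three edges *)

Section FourThree.
Variable R : realType.

(** All subgraphs of the incidence graph over a field with $2^k$ elements are sparse, where $k$
    is maximal with $2 \cdot 4^k \le n$. *)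
Lemma ln_cardF43_ge n (Y : R) : (8 <= n)%N -> 1 <= Y -> Y ^+ 8 = n%:R ->
  Y ^+ 12 * (ln 2 / 27) <= ln (cardF n 4 3)%:R.
Proof.
move=> n8 Y1 Y8; have Y0 : 0 < Y by apply: lt_le_trans Y1.
pose k := trunc_log 4 n./2.
have /andP[k1 k2] : (4 ^ k <= n./2 < 4 ^ k.+1)%N by apply: trunc_log_bounds => //; lia.
have k0 : (0 < k)%N by rewrite lt0n; apply/negP => /eqP k0; move: k2; rewrite k0; lia.
have [Fq _ cF] := pPrimePowerField (isT : prime 2) k0.
have four_pow : (4 ^ k = (2 ^ k) ^ 2)%N by rewrite -expnM mulnC expnM.
have Q_le : (2 * #|{: Fq}| ^ 2 <= n)%N.
  by rewrite cF -four_pow; move: k1; clear; lia.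
have Q_ge : (n <= 8 * #|{: Fq}| ^ 2)%N.
  by rewrite cF -four_pow; move: k2; rewrite expnS; clear; lia.
set q := #|{: Fq}| in Q_le Q_ge.
have card_ge : (2 ^ (q ^ 3) <= cardF n 4 3)%N.
  rewrite cardF_sparse_array //; last by apply: leq_trans n8.
  pose G := @incidence_graph Fq n Q_le.
  apply: (@leq_trans (\prod_(e : pairs 'I_n) (e \in G : nat).+1)).
    rewrite (eq_bigr (fun e => if e \in G then 2 else 1)%N) => [|e _]; last by case: (e \in G).
    by rewrite prod_two_values exp1n muln1 leq_exp2l // card_incidence_graph.
  apply: prod_le_sparse => //; first by rewrite card_ord; apply: leq_trans n8.
  exact: incidence_graph_sparse.
have lnF : (q ^ 3)%:R * ln 2 <= ln (cardF n 4 3)%:R :> R.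
  have lnq : ln ((2 ^ (q ^ 3))%:R : R) = (q ^ 3)%:R * ln 2.
    by rewrite natrX lnXn // mulr_natl.
  rewrite -lnq ler_ln ?posrE ?ltr0n ?expn_gt0 ?ler_nat //.
  by apply: leq_trans card_ge; rewrite expn_gt0.
apply: le_trans lnF; rewrite mulrA mulrAC ler_wpM2r ?ln_ge0 ?ler1n //.
rewrite ler_pdivrMr // natrX.
have Y4 : Y ^+ 4 <= 3 * q%:R.
  rewrite -(@ler_pXn2r _ 2) ?nnegrE ?exprn_ge0 ?mulr_ge0 ?(ltW Y0) //.
  rewrite -exprM Y8 exprMn -!natrX -natrM ler_nat.
  by apply: leq_trans Q_ge _; rewrite leq_mul2r orbT.
have -> : Y ^+ 12 = Y ^+ 4 ^+ 3 by rewrite -exprM.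
have -> : q%:R ^+ 3 * 27 = (3 * q%:R) ^+ 3 :> R by ring.
by rewrite lerXn2r ?nnegrE ?exprn_ge0 ?mulr_ge0 ?(ltW Y0).
Qed.

Local Open Scope classical_set_scope.

Lemma part_four_three :
  exists2 f : nat -> R, f =Theta_\oo (fun n : nat => n%:R `^ (3 / 2) : R) &
     \forall n \near \oo, (cardF n 4 3)%:R = 2 `^ f n.
Proof.
pose f n : R := ln (cardF n 4 3)%:R / ln 2.
have ln2 : 0 < ln (2 : R) by rewrite ln_gt0 // ltr1n.
have root n : (8 <= n)%N -> exists Y : R,
    [/\ 1 <= Y, Y ^+ 8 = n%:R & `|n%:R `^ (3 / 2)| = Y ^+ 12 :> R].
  move=> n8; have [Y [Y0 Y8 Y1]] := exists_root8 R n.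
  exists Y; split=> //; first by apply: Y1; apply: leq_trans n8.
  rewrite ger0_norm ?powR_ge0 // -Y8 -powR_mulrn // -powRrM -powR_mulrn //; congr (_ `^ _).
  lra.
have f_ge0 n : (8 <= n)%N -> 0 <= f n.
  move=> n8; rewrite divr_ge0 ?(ltW ln2) // ln_ge0 // ler1n.
  rewrite cardF_sparse_array //; last by apply: leq_trans n8.
  by rewrite -(ltr_nat R) sparse_array_gt0.
exists f; last first.
  exists 8%N => // n /= n8; rewrite /powR gt_eqF // /f divfK ?gt_eqF // lnK // posrE ltr0n.
  rewrite cardF_sparse_array //; last by apply: leq_trans n8.
  by rewrite -(ltr_nat R) sparse_array_gt0.
rewrite eqThetaE bigThetaE; split.
  apply/eqOP; near=> K; exists 8%N => // n /= n8.
  have [Y [Y1 Y8 ->]] := root n n8.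
  rewrite (ger0_norm (f_ge0 n n8)) /f ler_pdivrMr //.
  apply: le_trans (ln_cardF43_le (leq_trans _ n8) Y1 Y8) _ => //.
  rewrite mulrAC ler_wpM2r ?exprn_ge0 //; first exact: le_trans Y1.
  rewrite -ler_pdivrMr //; near: K; apply: nbhs_pinfty_ge; exact: num_real.
apply/asboolP; exists (27^-1); first by rewrite invr_gt0.
exists 8%N => // n /= n8; have [Y [Y1 Y8 ->]] := root n n8.
rewrite (ger0_norm (f_ge0 n n8)) /f ler_pdivlMr //.
apply: le_trans (ln_cardF43_ge n8 Y1 Y8).
by rewrite le_eqVlt; apply/orP; left; apply/eqP; field.
Unshelve. all: by end_near.
Qed.

End FourThree.

Local Open Scope classical_set_scope.

Theorem theorem6 (R : realType) :
  (forall s q a b : nat, (2 <= s)%N -> q = (a * 'C(s, 2) + b)%N ->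
    ((b <= s - 2)%N ->
       exists2 f : nat -> R, f =o_\oo (fun n : nat => n%:R ^+ 2 : R) &
         \forall n \near \oo,
           (cardF n s q)%:R = (a + 1)%:R ^+ 'C(n, 2) * 2 `^ f n)
    /\
    (forall t : nat, (2 <= t)%N -> t%:R <= s%:R / 2 :> R ->
       b = ('C(s, 2) - t)%N ->
       exists2 f : nat -> R, f =o_\oo (fun n : nat => n%:R ^+ 2 : R) &
         \forall n \near \oo,
           (cardF n s q)%:R =
             (a + 1)%:R ^+ 'C(n, 2) *
             ((a + 2)%:R / (a + 1)%:R) `^ ((turan_number (s - t) n)%:R + f n)))
  /\
  (exists2 f : nat -> R, f =Theta_\oo (fun n : nat => n%:R `^ (3 / 2) : R) &
     \forall n \near \oo, (cardF n 4 3)%:R = 2 `^ f n).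
Proof.
split; last exact: part_four_three.
move=> s q a b s2 qE; split=> [|t t2 ts bE]; first exact: part_small_excess.
exact: (part_turan s2 qE t2 ts bE).
Qed.
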